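(* Every function $u:\mathcal{G}_0\to\mathbb{R}$ which is 1-Lipschitz, i.e. $|u(g)-u(h)|\le\|g-h\|_{L^2}$ for all $g,h\in\mathcal{G}_0$, belongs to $\mathrm{Dom}(\mathbb{E})$ and satisfies $\Gamma(u,u)\le1$ $\mathbb{Q}_0^\beta$-a.e. on $\mathcal{G}_0$.
   Context: $\mathcal{G}_0$ is the set of right continuous nondecreasing maps $g:[0,1[\,\to[0,1]$ extended by $g(1):=1$, with $\|g-h\|_{L^2}=(\int_0^1|g-h|^2dt)^{1/2}$. Fix $\beta>0$; $\mathbb{Q}_0^\beta$ is the probability measure on $\mathcal{G}_0$ such that for every $N$ and $0=t_0<\dots<t_{N+1}=1$ the law of $(g(t_1),\dots,g(t_N))$ is $\frac{\Gamma(\beta)}{\prod_{i=0}^{N}\Gamma(\beta(t_{i+1}-t_i))}\prod_{i=0}^{N}(x_{i+1}-x_i)^{\beta(t_{i+1}-t_i)-1}dx$ on $\{0<x_1<\dots<x_N<1\}$, $x_0:=0,x_{N+1}:=1$. For $u(g)=U(\int_0^1\vec\alpha(g_s)ds)$ with $U\in\mathcal{C}^1(\mathbb{R}^m)$, $\vec\alpha\in\mathcal{C}^1([0,1],\mathbb{R}^m)$ (class $\mathfrak{Z}^1(\mathcal{G}_0)$), $\mathbb{D}u(g)=\sum_i\partial_iU(\int\vec\alpha(g_s)ds)\alpha_i'(g(\cdot))\in L^2([0,1])$. $(\mathbb{E},\mathrm{Dom}(\mathbb{E}))$ is the closure in $L^2(\mathcal{G}_0,\mathbb{Q}_0^\beta)$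 of $\mathbb{E}(u,v)=\int\langle\mathbb{D}u,\mathbb{D}v\rangle_{L^2}d\mathbb{Q}_0^\beta$ on $\mathfrak{Z}^1(\mathcal{G}_0)$, $\overline{\mathbb{D}}$ the closure of $\mathbb{D}$ (so $\mathrm{Dom}(\mathbb{E})=\mathrm{Dom}(\overline{\mathbb{D}})$), and $\Gamma(u,u):=\|\overline{\mathbb{D}}u\|^2_{L^2([0,1])}$. *)

(* Defs.v *)
From HB Require Import structures.
From mathcomp Require Import all_boot all_order all_algebra.
From mathcomp Require Import all_classical all_reals all_analysis.
Import Order.TTheory GRing.Theory Num.Theory.
Import numFieldNormedType.Exports.

Set Implicit Arguments.
Unset Strict Implicit.
Unset Printing Implicit Defensive.

Local Open Scope classical_set_scope.
Local Open Scope ring_scope.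

Section G0_space.
Variable R : realType.

Definition int01 (f : R -> R) : R :=
  fine (\int[@lebesgue_measure R]_(x in `[0%R, 1%R]) (f x)%:E)%E.

(** Elements of G_0, represented as functions R -> R: g restricted to [0,1[
    is right continuous, nondecreasing, with values in [0,1]; g(1) := 1.
    Fixed (inessential) convention outside [0,1]: g = 0 on ]-oo,0[ and
    g = 1 on [1,+oo[. *)
Definition isG0 (g : R -> R) : Prop :=
  [/\ (forall t, t < 0 -> g t = 0),
      (forall t, 1 <= t -> g t = 1),
      (forall t, 0 <= t -> t < 1 -> 0 <= g t <= 1),
      (forall s t, 0 <= s -> s <= t -> t < 1 -> g s <= g t) &
      (forall t, 0 <= t -> t < 1 -> g x @[x --> t^'+] --> g t)].

Record G0 := MkG0 { G0fun :> R -> R ; G0P : isG0 G0fun }.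

Definition step01 (t : R) : R := if t < 1 then 0 else 1.

Lemma step01_G0 : isG0 step01.
Proof.
rewrite /step01; split.
- by move=> t t0; rewrite ifT // (lt_trans t0) // ltr01.
- by move=> t t1; rewrite ifF //; apply/negbTE; rewrite -leNgt.
- by move=> t _ ->; rewrite lexx ler01.
- by move=> s t _ st t1; rewrite (le_lt_trans st t1) t1.
move=> t _ t1; rewrite t1.
apply: cvg_near_cst.
exists (1 - t) => /=; first by rewrite subr_gt0.
move=> y /= + ty. rewrite ltr_distlC => /andP[_].
by rewrite addrCA subrr addr0 => ->.
Qed.

HB.instance Definition _ := gen_eqMixin G0.
HB.instance Definition _ := gen_choiceMixin G0.
HB.instance Definition _ := isPointed.Build G0 (MkG0 step01_G0).

Definition G0_cylinders : set (set G0) :=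
  [set B | exists t : R, exists A : set R, measurable A /\
           B = (fun g : G0 => G0fun g t) @^-1` A].

Definition G0m := g_sigma_algebraType G0_cylinders.

Definition L2dist (g h : R -> R) : R := Num.sqrt (int01 (fun t => (g t - h t) ^+ 2)).

Definition Gamma (a : R) : R :=
  fine (\int[@lebesgue_measure R]_(x in [set x : R | (0 < x)%R])
           ((powR x (a - 1) * expR (- x))%R)%:E)%E.

Fixpoint iint (n : nat) (f : seq R -> \bar R) : \bar R :=
  match n with
  | O => f [::]
  | n'.+1 => (\int[@lebesgue_measure R]_x iint n' (fun s => f (x :: s)))%E
  end.

Definition grid (s : seq R) : seq R := 0 :: s ++ [:: 1].
Definition gaps (s : seq R) : seq R := [seq p.2 - p.1 | p <- zip s (behead s)].

Definition dir_density (beta : R) (ts xs : seq R) : R :=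
  if (size xs == size ts) && sorted <%R (grid xs) then
    Gamma beta / (\prod_(d <- gaps (grid ts)) Gamma (beta * d)) *
    \prod_(p <- zip (gaps (grid ts)) (gaps (grid xs))) powR p.2 (beta * p.1 - 1)
  else 0.

(** Q is the entropic measure Q_0^beta: for all 0 < t_1 < ... < t_N < 1 the
    law of (g(t_1),...,g(t_N)) has the Dirichlet density above; stated via
    the joint distribution function (which determines the law). *)
Definition entropic_measure (beta : R) (Q : probability G0m R) : Prop :=
  forall ts : seq R, sorted <%R (grid ts) ->
  forall cs : seq R, size cs = size ts ->
    Q [set g : G0m | forall i, (i < size ts)%N ->
                     G0fun g (nth 0 ts i) <= nth 0 cs i] =
    iint (size ts) (fun xs => (dir_density beta ts xs *
                  (if all2 (fun x c => x <= c) xs cs then 1 else 0))%:E).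

Definition partial (m : nat) (U : 'rV[R]_m -> R) (i : 'I_m) (x : 'rV[R]_m) : R :=
  derive1 (fun s : R => U (x + s *: delta_mx 0 i)) 0.

Definition C1_Rm (m : nat) (U : 'rV[R]_m -> R) : Prop :=
  forall i : 'I_m,
    (forall x, derivable (fun s : R => U (x + s *: delta_mx 0 i)) 0 1) /\
    continuous (partial U i).

(** a in C^1([0,1]) (read: a is the restriction of a C^1 function on R). *)
Definition C1_R (a : R -> R) : Prop :=
  (forall x, derivable a x 1) /\ continuous (derive1 a).

Record Z1data := MkZ1 {
  z_m : nat;
  z_U : 'rV[R]_z_m -> R;
  z_alpha : 'I_z_m -> R -> R;
  z_U_C1 : C1_Rm z_U;
  z_alpha_C1 : forall i, C1_R (z_alpha i) }.

Definition z_moments (z : Z1data) (g : G0) : 'rV[R]_(z_m z) :=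
  \row_i int01 (fun s => @z_alpha z i (G0fun g s)).

Definition z_fun (z : Z1data) (g : G0) : R := @z_U z (z_moments z g).

Definition z_grad (z : Z1data) (g : G0) (t : R) : R :=
  \sum_(i < z_m z) partial (@z_U z) i (z_moments z g) * derive1 (@z_alpha z i) (G0fun g t).

(** F is (a representative of) the closed gradient \bar D u of u, i.e. u lies
    in the domain of the closure of (E, Z^1) and \bar D u = F: there are
    u_n in Z^1 with u_n -> u in L^2(Q) and D u_n -> F in L^2(Q; L^2([0,1])). *)
Definition closed_gradient (Q : probability G0m R) (u : G0m -> R)
    (F : G0m -> R -> R) : Prop :=
  [/\ measurable_fun setT u,
      measurable_fun setT (fun p : G0m * R => F p.1 p.2) &
      exists z : nat -> Z1data,
        ((fun n => \int[Q]_g ((z_fun (z n) g - u g) ^+ 2)%R%:E) @ \oo --> 0%E) /\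
        ((fun n => \int[Q]_g (\int[@lebesgue_measure R]_(t in `[0%R, 1%R])
                      ((z_grad (z n) g t - F g t) ^+ 2)%R%:E)) @ \oo --> 0%E)]%E.

Definition in_DomE (Q : probability G0m R) (u : G0m -> R) : Prop :=
  exists F, closed_gradient Q u F.

Definition carre_du_champ (F : G0m -> R -> R) (g : G0m) : \bar R :=
  (\int[@lebesgue_measure R]_(t in `[0%R, 1%R]) ((F g t) ^+ 2)%R%:E)%E.

End G0_space.

(* Main.v *)
(** A point of G_0 is the quantile function of a probability measure on [0,1],
    and u is 1-Lipschitz for the L^2 distance, so u g is the minimum over h of
    u h + |g - h|; since G_0 is totally bounded, a finite net of h suffices up to
    a uniform error.  Each squared distance
      |g - h|^2 = int g^2 - 2 int g h + int h^2
    is a function of the distribution of g alone, because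
      int g h = int_0^1 H (|{g > c}|) dc,  H r = int_(1-r)^1 h,
    for nondecreasing g and h.  Smoothing the indicators ]c, +oo[ and replacing the
    integral in c by a Riemann sum turns it into a cylinder function W with
    gradient 2 (g - D), where D averages values of h over g.  By Jensen's
    inequality and summation by parts |g - D|^2 <= W up to an error that is added
    to W, so sqrt W has gradient of norm at most 1 at *every* g.  A soft minimum
    of the functions u h + sqrt W has a gradient that is a convex combination of
    theirs.  Hence u is a uniform limit of functions of class Z^1 with gradients
    of norm at most 1 everywhere.

    The functions of class Z^1 that are eps-close to u with gradients of norm at
    most 1 form nested convex sets, so by the parallelogram identity near-minimisers
    of the L^2 norm of the gradient have gradients that converge strongly.  A
    pointwise limit F of a fast subsequence is the closed gradient of u, and the
    bound on the norm passes to F by Fatou's lemma. *)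

Require Import Defs.
From HB Require Import structures.
From mathcomp Require Import all_boot all_order all_algebra.
From mathcomp Require Import all_classical all_reals all_analysis.
From mathcomp Require Import measurable_realfun ring lra.
Import Order.TTheory GRing.Theory Num.Theory.
Import numFieldNormedType.Exports.
Set Implicit Arguments.
Unset Strict Implicit.
Unset Printing Implicit Defensive.
Local Open Scope classical_set_scope.
Local Open Scope ring_scope.

(** * Bounded measurable functions on [0,1] *)

Section BoundedMeasurable.
Variable R : realType.
Implicit Types f g : R -> R.

Definition bmf f := measurable_fun setT f /\ exists C, forall x, `|f x| <= C.

Lemma bmf_cst c : bmf (fun=> c).
Proof. by split; [exact: measurable_cst | exists `|c|]. Qed.

Lemma bmfD f g : bmf f -> bmf g -> bmf (fun x => f x + g x).
Proof.
move=> [mf [C fC]] [mg [D gD]]; split; first exact: measurable_funD.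
by exists (C + D) => x; apply: le_trans (ler_normD _ _) (lerD _ _).
Qed.

Lemma bmfM f g : bmf f -> bmf g -> bmf (fun x => f x * g x).
Proof.
move=> [mf [C fC]] [mg [D gD]]; split; first exact: measurable_funM.
by exists (C * D) => x; rewrite normrM ler_pM.
Qed.

Lemma bmfZ c f : bmf f -> bmf (fun x => c * f x).
Proof. by move=> bf; apply: bmfM => //; exact: bmf_cst. Qed.

Lemma bmfN f : bmf f -> bmf (fun x => - f x).
Proof.
move=> bf; rewrite (_ : (fun _ => _) = (fun x => -1 * f x)); first exact: bmfZ.
by apply/funext => x; rewrite mulN1r.
Qed.

Lemma bmfB f g : bmf f -> bmf g -> bmf (fun x => f x - g x).
Proof. by move=> bf bg; apply: bmfD => //; exact: bmfN. Qed.

Lemma bmf_sqr f : bmf f -> bmf (fun x => f x ^+ 2).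
Proof.
move=> bf; rewrite (_ : (fun _ => _) = (fun x => f x * f x)); first exact: bmfM.
by apply/funext => x; rewrite expr2.
Qed.

Lemma bmf_sum (I : Type) (r : seq I) (F : I -> R -> R) :
  (forall i, bmf (F i)) -> bmf (fun x => \sum_(i <- r) F i x).
Proof.
move=> bF; elim: r => [|i r IH].
  by rewrite (_ : (fun _ => _) = fun=> 0);
    [exact: bmf_cst | apply/funext => x; rewrite big_nil].
rewrite (_ : (fun _ => _) = fun x => F i x + \sum_(j <- r) F j x); first exact: bmfD.
by apply/funext => x; rewrite big_cons.
Qed.

Lemma bmf_integrable f : bmf f ->
  (@lebesgue_measure R).-integrable `[0%R, 1%R] (EFin \o f).
Proof.
move=> [mf [C fC]]; apply: measurable_bounded_integrable => //.
- by rewrite /= lebesgue_measure_itv /= lte_fin ltr01 oppr0 adde0 ltry.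
- exact: measurable_funTS.
exists C; split; first exact: num_real.
by move=> M CM x _ /=; exact: le_trans (fC x) (ltW CM).
Qed.

Lemma bmf_integrableS f (D : set R) : bmf f -> measurable D ->
  D `<=` `[0%R, 1%R]%classic -> (@lebesgue_measure R).-integrable D (EFin \o f).
Proof. by move=> bf mD D01; exact: integrableS (bmf_integrable bf). Qed.

Lemma int01E f : int01 f = \int[@lebesgue_measure R]_(x in `[0%R, 1%R]) f x.
Proof. by []. Qed.

Lemma int01_EFin f : bmf f ->
  (\int[@lebesgue_measure R]_(x in `[0%R, 1%R]) (f x)%:E)%E = (int01 f)%:E.
Proof.
move=> bf; rewrite /int01 fineK//.
exact: (integrable_fin_num _ (bmf_integrable bf)).
Qed.

Lemma int01D f g : bmf f -> bmf g ->
  int01 (fun x => f x + g x) = int01 f + int01 g.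
Proof. by move=> bf bg; rewrite !int01E RintegralD //; exact: bmf_integrable. Qed.

Lemma int01Z c f : bmf f -> int01 (fun x => c * f x) = c * int01 f.
Proof. by move=> bf; rewrite !int01E RintegralZl //; exact: bmf_integrable. Qed.

Lemma int01B f g : bmf f -> bmf g ->
  int01 (fun x => f x - g x) = int01 f - int01 g.
Proof. by move=> bf bg; rewrite !int01E RintegralB //; exact: bmf_integrable. Qed.

Lemma int01_cst (c : R) : int01 (fun=> c) = c.
Proof.
rewrite int01E Rintegral_cst // /= lebesgue_measure_itv /= lte_fin ltr01.
by rewrite oppr0 adde0 /= mulr1.
Qed.

Lemma int01_sum (I : Type) (r : seq I) (F : I -> R -> R) :
  (forall i, bmf (F i)) ->
  int01 (fun x => \sum_(i <- r) F i x) = \sum_(i <- r) int01 (F i).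
Proof.
move=> bF; elim: r => [|i r IH].
  by rewrite big_nil -[RHS](int01_cst 0); congr int01; apply/funext => x; rewrite big_nil.
rewrite big_cons -IH -int01D //; last exact: bmf_sum.
by congr int01; apply/funext => x; rewrite big_cons.
Qed.

Lemma le_int01 f g : bmf f -> bmf g ->
  (forall x, 0 <= x <= 1 -> f x <= g x) -> int01 f <= int01 g.
Proof.
move=> bf bg fg; rewrite !int01E; apply: le_Rintegral.
- by [].
- exact: bmf_integrable.
- exact: bmf_integrable.
by move=> x; rewrite /= in_itv /=; exact: fg.
Qed.

Lemma int01_ge0 f : (forall x, 0 <= x <= 1 -> 0 <= f x) -> 0 <= int01 f.
Proof.
move=> f0; rewrite int01E; apply: Rintegral_ge0 => x.
by rewrite /= in_itv /=; exact: f0.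
Qed.

Lemma eq_int01 f g : (forall x, 0 <= x <= 1 -> f x = g x) -> int01 f = int01 g.
Proof.
move=> fg; rewrite !int01E; apply: eq_Rintegral => x.
by rewrite inE /= in_itv /=; exact: fg.
Qed.

(** The endpoint 1 is a null set. It has to be ignored because every element of G_0 equals 1 there,
    whereas a quantile function given by a profile may not. *)
Lemma eq_int01_co f g : bmf f -> bmf g ->
  (forall x, 0 <= x < 1 -> f x = g x) -> int01 f = int01 g.
Proof.
move=> bf bg fg; rewrite !int01E.
have sub : `[0%R, 1%R[%classic `<=` (`[0%R, 1%R]%classic : set R).
  by apply: subset_itvl; rewrite bnd_simp.
rewrite -(Rintegral_itv_bndo_bndc (bmf_integrableS bf _ sub)) //.
rewrite -(Rintegral_itv_bndo_bndc (bmf_integrableS bg _ sub)) //.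
by apply: eq_Rintegral => x; rewrite inE /= in_itv /=; exact: fg.
Qed.

Lemma nondecreasing_bmf f (C : R) : {homo f : x y / x <= y} ->
  (forall x, `|f x| <= C) -> bmf f.
Proof.
move=> fnd fC; split; last by exists C.
by apply: nondecreasing_measurable => // x y; exact: fnd.
Qed.

Lemma bmf_gt (a : R) : bmf (fun s => ((a < s)%R)%:R : R).
Proof.
apply: (@nondecreasing_bmf _ 1) => [x y xy|x].
  rewrite ler_nat; case: (ltP a x) => //= ax.
  by rewrite (lt_le_trans ax xy).
by case: (_ < _); rewrite ?normr1 ?normr0.
Qed.

(** Upper intervals ]1 - a, 1] are handled as indicator factors, so that integrals over them can be
    compared pointwise on all of [0,1]. *)
Lemma int01_restr f (a : R) : bmf f -> 0 <= a <= 1 ->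
  int01 (fun s => f s * ((1 - a < s)%R)%:R) =
  \int[@lebesgue_measure R]_(x in `[1 - a, 1]) f x.
Proof.
move=> bf /andP[a0 a1]; rewrite int01E -[RHS]Rintegral_itv_obnd_cbnd; last first.
  apply: bmf_integrableS => // x /=; rewrite !in_itv /= => /andP[ax ->].
  by rewrite (le_trans _ (ltW ax)) ?subr_ge0.
have -> : `]1 - a, 1]%classic = `[0%R, 1%R] `&` `]1 - a, +oo[%classic :> set R.
  apply/seteqP; split => x /=; rewrite !in_itv /= ?andbT.
    by move=> /andP[ax ->]; rewrite ax (le_trans _ (ltW ax)) ?subr_ge0.
  by move=> [/andP[_ ->] ->].
rewrite Rintegral_mkcondr; apply: eq_Rintegral => x _.
rewrite /patch mem_setE in_itv /= andbT.
by case: (1 - a < x); rewrite ?mulr1 ?mulr0.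
Qed.

Lemma int01_gt (a : R) : 0 <= a <= 1 -> int01 (fun s => ((1 - a < s)%R)%:R : R) = a.
Proof.
move=> a01; have /andP[a0 a1] := a01.
rewrite -(@eq_int01 (fun s => 1 * ((1 - a < s)%R)%:R)); last by move=> *; rewrite mul1r.
rewrite (int01_restr (bmf_cst 1)) // Rintegral_cst // /= lebesgue_measure_itv /= lte_fin.
have [a00|] := ltP (1 - a) 1; first by rewrite mul1r /= opprB addrCA subrr addr0.
by rewrite lerBrDr gerDl => a0'; rewrite mulr0; apply/eqP; rewrite eq_le a0 a0'.
Qed.

End BoundedMeasurable.

(** * Derivatives from quadratic error bounds, and the positive part *)

Section Calculus.
Variable R : realType.

(* Quadratic error bounds avoid any case analysis at the kink of [relu]. *)
Lemma is_derive_quadratic (f : R -> R) (x d C : R) :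
  (forall h, `|f (x + h) - f x - h * d| <= C * h ^+ 2) -> is_derive x 1 f d.
Proof.
move=> fC.
have C0 : 0 <= C by have := le_trans (normr_ge0 _) (fC 1); rewrite expr1n mulr1.
have fd : h^-1 *: (f (h *: (1 : R) + x) - f x) @[h --> 0^'] --> d.
  apply/cvgrPdist_le => e e0.
  have C1 : 0 < C + 1 by lra.
  have eC : 0 < e / (C + 1) by exact: divr_gt0.
  near=> h.
  have h0 : h != 0 by near: h; exact: nbhs_dnbhs_neq.
  have := fC h; rewrite [h *: _]mulr1 [_ *: _]mulrC (addrC h x) => fh.
  rewrite -[X in `|X - _|](mulfK h0) -mulrBl normrM normfV distrC (mulrC d).
  rewrite ler_pdivrMr ?normr_gt0 // (le_trans fh) //.
  rewrite -real_normK ?num_real // expr2 mulrA ler_wpM2r //.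
  have : `|h| <= e / (C + 1) by near: h; exact: (@dnbhs0_le _ R^o).
  rewrite ler_pdivlMr // => he; apply: le_trans he; rewrite mulrC ler_wpM2l //; lra.
by apply: DeriveDef; [apply/cvg_ex; exists d | exact/cvg_lim].
Unshelve. all: by end_near.
Qed.

Definition relu (x : R) : R := Num.max x 0.

Lemma reluE x : relu x = if 0 <= x then x else 0.
Proof. by rewrite /relu /Num.max; case: ltgtP => // ->. Qed.

Lemma relu_lip x y : `|relu x - relu y| <= `|x - y|.
Proof.
rewrite !reluE; case: (leP 0 x) => ?; case: (leP 0 y) => ? //;
  rewrite ?subr0 ?sub0r ?subrr ?normr0 // ?normrN.
- by rewrite !ger0_norm; lra.
- by rewrite ger0_norm // ler0_norm; lra.
Qed.

Lemma lip_continuous (f : R -> R) (C : R) :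
  (forall x y, `|f x - f y| <= C * `|x - y|) -> continuous f.
Proof.
move=> fC x; apply/cvgrPdist_le => e e0.
have C0 : 0 <= C by have := le_trans (normr_ge0 _) (fC 1 0); rewrite subr0 normr1 mulr1.
have C1 : 0 < C + 1 by lra.
near=> y; apply: le_trans (fC _ _) _.
have : `|x - y| <= e / (C + 1).
  by near: y; apply: cvgr_dist_le; [exact: cvg_id | exact: divr_gt0].
rewrite ler_pdivlMr // => h; apply: le_trans h; rewrite mulrC ler_wpM2l //; lra.
Unshelve. all: by end_near.
Qed.

End Calculus.

(** * A C^1 step function *)

Section Bump.
Variable R : realType.
Implicit Types x t : R.

(** [relu ^+ 2 / 2] is a convex function whose derivative [relu] is 1-Lipschitz: convexity gives the
    lower bound, the Lipschitz constant the upper one. *)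
Lemma relu_quadratic x h :
  0 <= relu (x + h) ^+ 2 / 2 - relu x ^+ 2 / 2 - h * relu x <= h ^+ 2 / 2.
Proof.
rewrite !reluE; case: (leP 0 (x + h)) => ?; case: (leP 0 x) => ?;
  apply/andP; split; nra.
Qed.

(* The primitive of the linear B-spline [hat] with knots 0, 1, 2. *)
Definition bump x : R :=
  relu x ^+ 2 / 2 - 2 * (relu (x - 1) ^+ 2 / 2) + relu (x - 2) ^+ 2 / 2.

Definition hat x : R := relu x - 2 * relu (x - 1) + relu (x - 2).

(** The three remainders lie in [0, h^2/2] and enter with coefficients 1, -2, 1, so their
    combination lies in [-h^2, h^2]. *)
Lemma bump_quadratic x h : `|bump (x + h) - bump x - h * hat x| <= h ^+ 2.
Proof.
have /andP[a0 a1] := relu_quadratic x h.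
have /andP[b0 b1] := relu_quadratic (x - 1) h.
have /andP[c0 c1] := relu_quadratic (x - 2) h.
rewrite /bump /hat (addrAC x h) (addrAC x h) ler_norml; apply/andP; split; lra.
Qed.

Lemma is_derive_bump x : is_derive x 1 bump (hat x).
Proof.
by apply: (@is_derive_quadratic _ _ _ _ 1) => h; rewrite mul1r bump_quadratic.
Qed.

Lemma hat_itv x : 0 <= hat x <= 1.
Proof.
rewrite /hat !reluE; case: (leP 0 x) => ?; case: (leP 0 (x - 1)) => ?;
  case: (leP 0 (x - 2)) => ?; apply/andP; split; lra.
Qed.

Lemma hat_le0 x : x <= 0 -> hat x = 0.
Proof.
rewrite /hat !reluE; case: (leP 0 x) => ?; case: (leP 0 (x - 1)) => ?;
  case: (leP 0 (x - 2)) => ?; lra.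
Qed.

Lemma hat_continuous : continuous hat.
Proof.
(* 4 = 1 + 2 + 1, the sum of the absolute coefficients of the three 1-Lipschitz terms. *)
apply: (@lip_continuous _ _ 4) => x y; rewrite /hat.
have := relu_lip x y; have := relu_lip (x - 1) (y - 1).
have := relu_lip (x - 2) (y - 2); rewrite !opprB !(addrA _ _ (- y)) !subrK.
rewrite !ler_norml => /andP[? ?] /andP[? ?] /andP[? ?].
by have [?|?] := leP 0 (x - y); apply/andP; split; lra.
Qed.

Lemma bump_le0 x : x <= 0 -> bump x = 0.
Proof.
rewrite /bump !reluE; case: (leP 0 x) => ?; case: (leP 0 (x - 1)) => ?;
  case: (leP 0 (x - 2)) => ?; nra.
Qed.

Lemma bump_ge2 x : 2 <= x -> bump x = 1.
Proof.
by move=> ?; rewrite /bump !reluE !ifT; [field|lra..].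
Qed.

Lemma bump_homo : {homo bump : x y / x <= y}.
Proof.
move=> x y xy; have [|c _] := MVT_segment xy (fun x _ => is_derive_bump x).
  apply: continuous_subspaceT => z; apply: differentiable_continuous.
  by apply/derivable1_diffP; have [] := is_derive_bump z.
have /andP[? _] := hat_itv c; rewrite -subr_ge0 => ->.
by rewrite mulr_ge0 ?subr_ge0.
Qed.

Lemma bump_itv x : 0 <= bump x <= 1.
Proof.
apply/andP; split; first have [?|?] := leP x 0.
- by rewrite bump_le0.
- by rewrite -(bump_le0 (lexx 0)) bump_homo // ltW.
have [?|?] := leP 2 x; first by rewrite bump_ge2.
by rewrite -(bump_ge2 (lexx 2)) bump_homo // ltW.
Qed.

End Bump.

(** * Bounds, monotonicity and measurability of elements of G_0 *)

Section G0_facts.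
Variable R : realType.

Lemma G0_itv (g : G0 R) t : 0 <= g t <= 1.
Proof.
have [g0 g1 g01 _ _] := G0P g.
have [t0|t0] := ltP t 0; first by rewrite g0 // lexx ler01.
by have [t1|t1] := ltP t 1; [exact: g01 | rewrite g1 // lexx ler01].
Qed.

Lemma G0_homo (g : G0 R) : {homo g : s t / s <= t}.
Proof.
move=> s t st; have [g0 g1 _ gh _] := G0P g.
have [s0|s0] := ltP s 0; first by rewrite g0 //; have /andP[] := G0_itv g t.
have [t1|t1] := ltP t 1; first exact: gh.
by rewrite (g1 t) //; have /andP[] := G0_itv g s.
Qed.

Lemma G0_bmf (g : G0 R) : bmf g.
Proof.
apply: (@nondecreasing_bmf _ _ 1); first exact: G0_homo.
by move=> x; have /andP[? ?] := G0_itv g x; rewrite ger0_norm.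
Qed.

Lemma G0_comp_bmf (g : G0 R) (a : R -> R) : continuous a -> bmf (fun s => a (g s)).
Proof.
move=> ca; split.
  apply: measurableT_comp; first exact: continuous_measurable_fun.
  by have [] := G0_bmf g.
have [c _ cP] := EVT_max ler01 (continuous_subspaceT (fun x => cvg_norm (ca x))).
exists `|a c| => x; apply: cP; rewrite in_itv /=; exact: G0_itv.
Qed.

End G0_facts.

(** * Concave profiles and the bathtub principle *)

Section FiniteSums.
Variable R : realType.

(** Jensen's inequality for weights of total mass at most S. Expanding the nonnegative sum of w_i
    (a_i S - D)^2 gives S^2 Q - 2 S D^2 + D^2 (sum of the w_i) >= 0; the last sum is at most S, and
    one factor S cancels. *)
Lemma sqr_sum_weights (I : Type) (r : seq I) (w a : I -> R) (S : R) :
  0 < S -> (forall i, 0 <= w i) -> \sum_(i <- r) w i <= S ->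
  (\sum_(i <- r) w i * a i) ^+ 2 <= S * \sum_(i <- r) w i * a i ^+ 2.
Proof.
move=> S0 w0 wS; set D := \sum_(i <- r) w i * a i; set Q := \sum_(i <- r) _ * _ ^+ 2.
have : 0 <= \sum_(i <- r) w i * (a i * S - D) ^+ 2.
  by apply: sumr_ge0 => i _; rewrite mulr_ge0 // sqr_ge0.
rewrite (eq_bigr (fun i => S ^+ 2 * (w i * a i ^+ 2) +
  ((- (2 * S * D)) * (w i * a i) + D ^+ 2 * w i))); last by move=> i _; ring.
rewrite !big_split /= -!mulr_sumr -/D -/Q => h.
have : D ^+ 2 * (\sum_(i <- r) w i) <= D ^+ 2 * S by rewrite ler_wpM2l ?sqr_ge0.
by move=> h'; rewrite -subr_ge0 -(pmulr_rge0 _ S0); nra.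
Qed.

(** Summation by parts. It is applied to [x i = H (tail i)], where the terms in [x n] vanish and
    [x 0] costs one cell of the Riemann sum. *)
Lemma sum_index_diff (x : nat -> R) n :
  \sum_(i < n) i%:R * (x i - x i.+1) = \sum_(i < n) x i - x 0%N + x n - n%:R * x n.
Proof.
elim: n => [|n IH]; first by rewrite !big_ord0; ring.
by rewrite !big_ord_recr /= IH -natr1; ring.
Qed.

End FiniteSums.

(** A Lipschitz quantile function h is encoded by its concave integral [prim r], the integral of h
    over [1 - r, 1], and by the derivative [slope r = h (1 - r)] of that integral. The quadratic
    bound gives both the derivative and a Taylor estimate with explicit constant. *)
Record profile (R : realType) := Profile {
  prim : R -> R;
  slope : R -> R;
  lip : R;
  lip_ge0 : 0 <= lip;
  prim_quadratic : forall x h, `|prim (x + h) - prim x - h * slope x| <= lip * h ^+ 2;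
  slope_lip : forall x y, `|slope x - slope y| <= lip * `|x - y|;
  slope_ni : forall x y, x <= y -> slope y <= slope x;
  slope_itv : forall x, 0 <= slope x <= 1;
  prim0 : prim 0 = 0 }.

Section Profile.
Variables (R : realType) (q : profile R).
Let H := prim q.
Let k := slope q.
Let L := lip q.

Lemma is_derive_prim (x : R) : is_derive x 1 H (k x).
Proof. exact: is_derive_quadratic (prim_quadratic q x). Qed.

Lemma slope_continuous : continuous k.
Proof. exact: lip_continuous (slope_lip q). Qed.

Definition quant (s : R) : R := k (1 - s).
Local Notation h := quant.

Lemma quant_bmf : bmf h.
Proof.
apply: (@nondecreasing_bmf _ _ 1) => [x y xy|x]; first by apply: slope_ni; lra.
by have /andP[? ?] := slope_itv q (1 - x); rewrite ger0_norm.
Qed.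

Lemma quant_continuous : continuous h.
Proof.
apply: (@lip_continuous _ _ L) => x y; apply: le_trans (slope_lip q _ _) _.
by rewrite opprB addrC addrA subrK distrC addrC.
Qed.

Lemma quant_itv s : 0 <= h s <= 1.
Proof. exact: slope_itv. Qed.

(** Fundamental theorem of calculus with the primitive [- H (1 - s)] of h on [1 - a, 1]; it requires
    a nondegenerate interval, hence the separate case a = 0. *)
Lemma prim_int01 a : 0 <= a <= 1 -> int01 (fun s => h s * ((1 - a < s)%R)%:R) = H a.
Proof.
move=> a01; rewrite int01_restr //; last exact: quant_bmf.
have /andP[a0 a1] := a01; have [a00|ap] := leP a 0.
  have -> : a = 0 by lra.
  by rewrite subr0 set_itv1 Rintegral_set1 /H prim0.
have dF (x : R) : is_derive x 1 (fun s => - H (1 - s)) (h x).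
  have d1 : is_derive x 1 (fun s : R => 1 - s) (- 1).
    apply: (@is_derive_quadratic _ _ _ _ 0) => y.
    by rewrite mul0r normr_le0; apply/eqP; ring.
  have := is_deriveN (@is_derive1_comp _ H (fun s => 1 - s) x _ _ (is_derive_prim (1 - x)) d1).
  by rewrite mulrN1 opprK.
have cF : continuous (fun s : R => - H (1 - s)).
  move=> x; apply: differentiable_continuous; apply/derivable1_diffP.
  by have [] := dF x.
rewrite /Rintegral (@continuous_FTC2 _ h (fun s => - H (1 - s))).
- by rewrite /= subrr (_ : 1 - (1 - a) = a); [rewrite /H prim0 oppr0 sub0r opprK|ring].
- lra.
- apply: continuous_subspaceT => x; exact: quant_continuous.
- split; [by move=> x _; have [] := dF x | exact/cvg_at_right_filter/cF
    | exact/cvg_at_left_filter/cF].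
- by move=> x _; rewrite derive1E; have [_ ->] := dF x.
Qed.

Lemma prim_itv a : 0 <= a <= 1 -> 0 <= H a <= 1.
Proof.
move=> a01; rewrite -prim_int01 //; apply/andP; split.
  by apply: int01_ge0 => s _; rewrite mulr_ge0 //; have /andP[] := quant_itv s.
rewrite -[leRHS](@int01_cst R); apply: le_int01.
- by apply: bmfM; [exact: quant_bmf | exact: bmf_gt].
- exact: bmf_cst.
by move=> s _; have /andP[? ?] := quant_itv s; case: (_ < _); rewrite ?mulr1 ?mulr0.
Qed.

(** Since h is nondecreasing, a density with values in [0,1] and mass a collects most of h when it
    fills ]1 - a, 1]. With the threshold [k a = h (1 - a)], the product of [h - k a] with f minus
    that indicator is pointwise nonpositive, and the threshold terms cancel because both masses are
    a. *)
Lemma bathtub f : bmf f -> (forall s, 0 <= f s <= 1) ->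
  int01 (fun s => h s * f s) <= H (int01 f).
Proof.
move=> bf f01; set a := int01 f.
have a01 : 0 <= a <= 1.
  apply/andP; split; first by apply: int01_ge0 => s _; have /andP[] := f01 s.
  rewrite -[leRHS](@int01_cst R); apply: le_int01 => //; first exact: bmf_cst.
  by move=> s _; have /andP[] := f01 s.
have bI := bmf_gt (1 - a); have bh := quant_bmf.
have bhf := bmfM bh bf; have bhI := bmfM bh bI.
have bkf := bmfZ (k a) bf; have bkI := bmfZ (k a) bI.
have : int01 (fun s => (h s * f s - h s * ((1 - a < s)%R)%:R)
   - (k a * f s - k a * ((1 - a < s)%R)%:R)) <= int01 (fun=> 0).
  apply: le_int01; [by do 2! apply: bmfB|exact: bmf_cst|].
  move=> s _; have /andP[? ?] := f01 s; case: ltP => as_.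
    by have : k a <= h s; [apply: slope_ni; lra | rewrite !mulr1; nra].
  by have : h s <= k a; [apply: slope_ni; lra | rewrite !mulr0; nra].
rewrite int01B ?int01B ?int01Z ?int01_gt ?prim_int01 ?int01_cst //; try exact: bmfB.
by rewrite -/a subrr subr0; lra.
Qed.

(** The converse of the bathtub bound for superlevel sets of a nondecreasing g: such a set is an
    upper interval of measure at least a, so it contains ]1 - a, 1]. *)
Lemma prim_le_upper (g : R -> R) c a : {homo g : s t / s <= t} -> 0 <= a <= 1 ->
  a <= int01 (fun s => ((c < g s)%R)%:R : R) ->
  H a <= int01 (fun s => h s * ((c < g s)%R)%:R).
Proof.
move=> gh a01 aS; rewrite -prim_int01 //.
have bS : bmf (fun s => ((c < g s)%R)%:R : R).
  apply: (@nondecreasing_bmf _ _ 1) => [x y xy|x].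
    by rewrite ler_nat; case: (ltP c (g x)) => //= cx; rewrite (lt_le_trans cx (gh _ _ xy)).
  by case: (_ < _); rewrite ?normr1 ?normr0.
apply: le_int01; [|exact: bmfM quant_bmf bS|].
  by apply: bmfM; [exact: quant_bmf|exact: bmf_gt].
move=> s s01; apply: ler_wpM2l; first by have /andP[] := quant_itv s.
rewrite ler_nat; case: (ltP (1 - a) s) => //= as_; case: (ltP c (g s)) => //= gc.
(* If s > 1 - a and g s <= c, then {g > c} lies in ]s, 1] and has measure at most 1 - s < a. *)
exfalso.
have s1 : 0 <= 1 - s <= 1 by lra.
suff : a <= 1 - s by lra.
apply: (le_trans aS); rewrite -(int01_gt s1); apply: le_int01 => //; first exact: bmf_gt.
move=> x _; rewrite ler_nat; case: (ltP c (g x)) => //= cx.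
rewrite opprB addrC subrK; case: (ltP s x) => //= xs.
by have := lt_le_trans cx (le_trans (gh _ _ xs) gc); rewrite ltxx.
Qed.

(** A lower Riemann sum: on ]1 - A i, 1 - A (i+1)] one has h s = k (1 - s) >= k (A i), because k is
    nonincreasing. *)
Lemma lower_sum (A : nat -> R) n : (forall i, 0 <= A i <= 1) ->
  (forall i, A i.+1 <= A i) ->
  \sum_(i < n) k (A i) ^+ 2 * (A i - A i.+1) <= int01 (fun s => h s ^+ 2).
Proof.
move=> A01 Ad; have bh := bmf_sqr quant_bmf.
have bhI i : bmf (fun s => h s ^+ 2 * ((1 - A i < s)%R)%:R).
  by apply: bmfM => //; exact: bmf_gt.
(* The slices are kept as a difference of two upper intervals, which telescopes in the induction. *)
suff : \sum_(i < n) k (A i) ^+ 2 * (A i - A i.+1) <=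
    int01 (fun s => h s ^+ 2 * ((1 - A 0%N < s)%R)%:R) -
    int01 (fun s => h s ^+ 2 * ((1 - A n < s)%R)%:R).
  move=> /le_trans; apply; rewrite lerBlDr -[leLHS]addr0 lerD //.
    apply: le_int01 => // s _; rewrite ler_piMr ?sqr_ge0 //.
    by case: (_ < _).
  by apply: int01_ge0 => s _; rewrite mulr_ge0 ?sqr_ge0.
elim: n => [|n IH]; first by rewrite big_ord0 subrr.
rewrite big_ord_recr /=.
suff : k (A n) ^+ 2 * (A n - A n.+1) <=
    int01 (fun s => h s ^+ 2 * ((1 - A n < s)%R)%:R) -
    int01 (fun s => h s ^+ 2 * ((1 - A n.+1 < s)%R)%:R) by lra.
rewrite -[X in X - A n.+1]int01_gt // -[X in _ - X]int01_gt //.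
have b1 := bmf_gt (1 - A n); have b2 := bmf_gt (1 - A n.+1).
rewrite -(int01B b1 b2) -int01Z; last exact: bmfB.
rewrite -int01B //; apply: le_int01; [exact/bmfZ/bmfB|exact: bmfB|].
move=> s _; have := Ad n; case: (ltP (1 - A n) s) => ?; case: (ltP (1 - A n.+1) s) => ? ?;
  rewrite ?subrr ?mulr0 ?mulr1 ?subrr ?subr0 //; last lra.
rewrite mulr1.
have : k (A n) <= h s by apply: slope_ni; lra.
by move=> kh; apply: lerXn2r => //; rewrite nnegrE; [have /andP[] := slope_itv q (A n)|have /andP[] := quant_itv s].
Qed.

End Profile.

(** * Smoothed tails *)

Section SmoothTails.
Variables (R : realType) (p : R) (M : nat).
Hypotheses (p1 : 1 <= p) (M0 : (0 < M)%N).

(* [tailc i] is a C^1 approximation, at scale [2 / p], of the indicator of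
   ]i / M, +oo[. *)
Definition tailc (i : nat) (x : R) : R := bump (p * (x - i%:R / M%:R)).
Definition dtailc (i : nat) (x : R) : R := p * hat (p * (x - i%:R / M%:R)).

(** [d] is the mesh 1/M seen at the scale of [bump], and [eta = M * d ^+ 2] is the total of one
    Taylor error d^2 per cell. *)
Let d : R := p / M%:R.
Let eta : R := p ^+ 2 / M%:R.

Let p0 : 0 < p. Proof. exact: lt_le_trans p1. Qed.
Let M0' : 0 < M%:R :> R. Proof. by rewrite ltr0n. Qed.

Lemma is_derive_tailc i (x : R) : is_derive x 1 (tailc i) (dtailc i x).
Proof.
apply: (@is_derive_quadratic _ _ _ _ (p ^+ 2)) => h.
have := bump_quadratic (p * (x - i%:R / M%:R)) (p * h).
by rewrite /tailc /dtailc exprMn; congr (`|bump _ - _ - _| <= _); ring.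
Qed.

Lemma dtailc_continuous i : continuous (dtailc i).
Proof.
move=> x; apply: cvgM; first exact: cvg_cst.
apply: (@cvg_comp _ _ _ (fun x => p * (x - i%:R / M%:R)) (@hat R) _
  (nbhs (p * (x - i%:R / M%:R)))); last exact: hat_continuous.
by apply: cvgM; [exact: cvg_cst | apply: cvgB; [exact: cvg_id | exact: cvg_cst]].
Qed.

Lemma tailc_continuous i : continuous (tailc i).
Proof.
move=> x; apply: differentiable_continuous; apply/derivable1_diffP.
by have [] := is_derive_tailc i x.
Qed.

(** Mesh times derivative, hence nearly the increment [tailc i x - tailc i.+1 x]; over i these
    weights are almost a subpartition of unity, and they turn the gradient of the Riemann sum into
    an average. *)
Definition wt i x := dtailc i x / M%:R.

Lemma wt_ge0 i x : 0 <= wt i x.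
Proof.
rewrite /wt /dtailc; have /andP[? _] := hat_itv (p * (x - i%:R / M%:R)).
by rewrite !mulr_ge0 ?invr_ge0 ?(ltW M0') ?(ltW p0).
Qed.

(** The weight vanishes unless x > i / M. *)
Lemma wt_support i x : wt i x * (i%:R / M%:R) <= wt i x * x.
Proof.
have [xi|xi] := leP x (i%:R / M%:R); last by rewrite ler_wpM2l ?wt_ge0 // ltW.
rewrite /wt /dtailc hat_le0 ?mulr0 ?mul0r //.
by rewrite mulr_ge0_le0 ?(ltW p0) // subr_le0.
Qed.

(** The quadratic bound for [bump] at the step -d, which moves cell i to cell i + 1. *)
Lemma wt_approx i x : `|wt i x - (tailc i x - tailc i.+1 x)| <= d ^+ 2.
Proof.
have := bump_quadratic (p * (x - i%:R / M%:R)) (- d).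
rewrite sqrrN /tailc /wt /dtailc /d; congr (_ <= _).
rewrite (_ : p * (x - i.+1%:R / M%:R) = p * (x - i%:R / M%:R) - p / M%:R); last first.
  by rewrite -natr1; ring.
by congr (`|_|); ring.
Qed.

Lemma tailc_itv i x : 0 <= tailc i x <= 1.
Proof. exact: bump_itv. Qed.

Lemma tailc_step i x : tailc i.+1 x <= tailc i x.
Proof.
apply: bump_homo; rewrite ler_wpM2l ?(ltW p0) //.
by rewrite lerD2l lerN2 ler_pM2r ?invr_gt0 // ler_nat.
Qed.

Lemma tailc_step_le i x : tailc i x - tailc i.+1 x <= d + d ^+ 2.
Proof.
have := wt_approx i x; rewrite ler_norml => /andP[h _].
have : wt i x <= d; last by lra.
rewrite /wt /dtailc /d ler_pM2r ?invr_gt0 // ler_piMr ?(ltW p0) //.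
by have /andP[] := hat_itv (p * (x - i%:R / M%:R)).
Qed.

Lemma sum_wt_le x : \sum_(i < M) wt i x <= 1 + eta.
Proof.
apply: (@le_trans _ _ (\sum_(i < M) ((tailc i x - tailc i.+1 x) + d ^+ 2))).
  apply: ler_sum => i _; have := wt_approx i x; rewrite ler_norml => /andP[_ h]; lra.
rewrite big_split /= sumr_const card_ord.
rewrite -(big_mkord xpredT (fun i => tailc i x - tailc i.+1 x)).
rewrite (telescope_sumr_eq (fun i => - tailc i x)) //; last by move=> i _; ring.
have /andP[? ?] := tailc_itv 0 x; have /andP[? ?] := tailc_itv M x.
rewrite -[d ^+ 2 *+ M]mulr_natr (_ : d ^+ 2 * M%:R = eta); first lra.
by rewrite /d /eta; field; rewrite gt_eqF.
Qed.

(** The smoothed indicator equals 1 as soon as i / M <= x - 2 / p, so smoothing loses at most 2 / p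
    of the layer-cake integral of x. *)
Lemma sum_tailc_ge x : x <= 1 -> x - 2 / p <= M%:R^-1 * \sum_(i < M) tailc i x.
Proof.
move=> x1.
set y := x - 2 / p.
have y1 : y <= 1.
  by have : 0 <= 2 / p; [rewrite divr_ge0 // ltW | rewrite /y; lra].
(* The increments of this truncation telescope to at least y and are bounded term by term by the
   smoothed indicators over M. *)
pose m (i : nat) := Num.min y (i%:R / M%:R).
apply: (@le_trans _ _ (\sum_(i < M) (m i.+1 - m i))).
  rewrite -(big_mkord xpredT (fun i => m i.+1 - m i)) telescope_sumr // /m.
  rewrite mul0r divff ?gt_eqF // (min_idPl y1).
  by rewrite lerBrDr gerDl ge_min lexx orbT.
rewrite mulr_sumr; apply: ler_sum => i _; rewrite /m.
have iM : i.+1%:R / M%:R = i%:R / M%:R + M%:R^-1 :> R by rewrite -natr1; ring.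
have Mi : 0 < M%:R^-1 :> R by rewrite invr_gt0.
have /andP[? ?] := tailc_itv i x.
have [yi|yi] := leP y (i%:R / M%:R).
  have : Num.min y (i.+1%:R / M%:R) <= y by rewrite ge_min lexx.
  have : 0 <= M%:R^-1 * tailc i x by rewrite mulr_ge0 // ltW.
  lra.
have -> : tailc i x = 1.
  rewrite /tailc bump_ge2 // mulrC -ler_pdivrMr //; rewrite /y in yi; lra.
by rewrite mulr1; have : Num.min y (i.+1%:R / M%:R) <= i.+1%:R / M%:R
  by [rewrite ge_min lexx orbT]; lra.
Qed.

Lemma sum_above_le x : 0 <= x ->
  M%:R^-1 * \sum_(i < M) ((i%:R / M%:R < x)%R)%:R <= x + M%:R^-1 :> R.
Proof.
move=> x0.
(* The shift by one makes the increment of index i equal to 1 / M exactly when i / M < x suffices;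
   the starting value -1 / M is the excess in the bound. *)
pose m (i : nat) := Num.min x ((i%:R - 1) / M%:R).
have Mi : 0 < M%:R^-1 :> R by rewrite invr_gt0.
apply: (@le_trans _ _ (\sum_(i < M) (m i.+1 - m i))); last first.
  rewrite -(big_mkord xpredT (fun i => m i.+1 - m i)) telescope_sumr // /m.
  rewrite sub0r mulN1r [X in _ - X]min_r; last lra.
  by rewrite opprK lerD2r ge_min lexx.
rewrite mulr_sumr; apply: ler_sum => i _; rewrite /m.
have iM : (i.+1%:R - 1) / M%:R = (i%:R - 1) / M%:R + M%:R^-1 :> R by rewrite -natr1; ring.
have iM' : (i.+1%:R - 1) / M%:R = i%:R / M%:R :> R by rewrite -natr1; ring.
case: (ltP (i%:R / M%:R) x) => xi.
  by rewrite mulr1 !min_r; lra.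
rewrite mulr0 subr_ge0 iM; apply: le_min2 => //; rewrite lerDl; exact: ltW.
Qed.

End SmoothTails.

(** * A smooth version of the squared distance to a fixed quantile function *)

Section SmoothDistance.
Variables (R : realType) (q : profile R) (p : R) (M : nat) (g : G0 R).
Hypotheses (p1 : 1 <= p) (M0 : (0 < M)%N).
Let H := prim q.
Let k := slope q.
Let L := lip q.
Let h := quant q.
Let d : R := p / M%:R.
Let eta : R := p ^+ 2 / M%:R.

Let p0 : 0 < p. Proof. exact: lt_le_trans p1. Qed.
Let M0' : 0 < M%:R :> R. Proof. by rewrite ltr0n. Qed.

Definition tail (i : nat) : R := int01 (fun s => tailc p M i (g s)).

(** The Riemann sum for the integral over c of H (|{g > c}|), with [tail i] in place of the measure
    of {g > i / M}; it approximates the integral of g h. *)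
Definition cross : R := M%:R^-1 * \sum_(i < M) H (tail i).

(** The gradient of [cross] at the value x of g: the average of values of h called D in the
    overview. *)
Definition dcross (x : R) : R := \sum_(i < M) k (tail i) * wt p M i x.

Let btail i : bmf (fun s => tailc p M i (g s)).
Proof. exact/G0_comp_bmf/tailc_continuous. Qed.

Let bwt i : bmf (fun s => wt p M i (g s)).
Proof.
rewrite /wt (_ : (fun _ => _) = fun s => M%:R^-1 * dtailc p M i (g s)).
  by apply: bmfZ; exact/G0_comp_bmf/dtailc_continuous.
by apply/funext => s; rewrite mulrC.
Qed.

Lemma dcross_bmf : bmf (fun s => dcross (g s)).
Proof. by apply: bmf_sum => i; apply: bmfZ. Qed.

Lemma tail_itv i : 0 <= tail i <= 1.
Proof.
apply/andP; split.
  by apply: int01_ge0 => s _; have /andP[] := tailc_itv p M i (g s).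
rewrite -[leRHS](@int01_cst R); apply: le_int01 => //; first exact: bmf_cst.
by move=> s _; have /andP[] := tailc_itv p M i (g s).
Qed.

Lemma tail_step i : tail i.+1 <= tail i.
Proof. by apply: le_int01 => // s _; exact: tailc_step. Qed.

Lemma tail_step_le i : tail i - tail i.+1 <= d + d ^+ 2.
Proof.
rewrite -int01B // -[leRHS](@int01_cst R); apply: le_int01.
- exact: bmfB.
- exact: bmf_cst.
by move=> s _; exact: tailc_step_le.
Qed.

Lemma tail_last : tail M = 0.
Proof.
rewrite -(@int01_cst R 0); apply: eq_int01 => s _; rewrite /tailc bump_le0 //.
have /andP[_ g1] := G0_itv g s.
by rewrite divff ?gt_eqF // mulr_ge0_le0 ?(ltW p0) // subr_le0.
Qed.

Lemma wt_int01 i : `|int01 (fun s => wt p M i (g s)) - (tail i - tail i.+1)| <= d ^+ 2.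
Proof.
rewrite -int01B // -int01B //; last exact: bmfB.
have b := bmfB (bwt i) (bmfB (btail i) (btail i.+1)).
rewrite ler_norml; apply/andP; split.
  rewrite -[leLHS](@int01_cst R); apply: le_int01 => //; first exact: bmf_cst.
  by move=> s _; have := wt_approx p M i (g s); rewrite ler_norml => /andP[].
rewrite -[leRHS](@int01_cst R); apply: le_int01 => //; first exact: bmf_cst.
by move=> s _; have := wt_approx p M i (g s); rewrite ler_norml => /andP[].
Qed.

Let slope01 i : 0 <= k (tail i) <= 1. Proof. exact: slope_itv. Qed.

Let sum_d : \sum_(i < M) d ^+ 2 = eta.
Proof.
rewrite sumr_const card_ord -[_ *+ M]mulr_natr /d /eta; field.
by rewrite gt_eqF.
Qed.

Hypothesis eta1 : eta <= 1.

Let eta0 : 0 <= eta. Proof. by rewrite divr_ge0 ?sqr_ge0 ?ltW. Qed.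
Let d0 : 0 <= d. Proof. by rewrite divr_ge0 ?ltW. Qed.
Let d_eta : d <= eta.
Proof. by rewrite /d /eta ler_pM2r ?invr_gt0 // expr2 ler_peMl // ltW. Qed.

Let Mi_eta : M%:R^-1 <= eta.
Proof. by rewrite /eta ler_peMl ?invr_ge0 ?(ltW M0') // expr_ge1 // ltW. Qed.

Lemma quant_sqr_itv : 0 <= int01 (fun s => h s ^+ 2) <= 1.
Proof.
apply/andP; split; first by apply: int01_ge0 => s _; exact: sqr_ge0.
rewrite -[leRHS](@int01_cst R); apply: le_int01; [exact/bmf_sqr/quant_bmf|exact: bmf_cst|].
by move=> s _; have /andP[? ?] := quant_itv q s; rewrite expr_le1.
Qed.

(** Jensen with weights of mass at most 1 + eta, then replacement of the integrated weights by
    increments of [tail], leave a lower Riemann sum of h^2. As eta and the integral of h^2 are at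
    most 1, (1 + eta)(int h^2 + eta) exceeds int h^2 by at most 3 eta. *)
Lemma dcross_sqr : int01 (fun s => dcross (g s) ^+ 2) <= int01 (fun s => h s ^+ 2) + 3 * eta.
Proof.
pose Sq s := \sum_(i < M) k (tail i) ^+ 2 * wt p M i (g s).
have bSq : bmf Sq by apply: bmf_sum => i; exact: bmfZ.
apply: (@le_trans _ _ (int01 (fun s => (1 + eta) * Sq s))).
  apply: le_int01; [exact/bmf_sqr/dcross_bmf|exact: bmfZ|] => s _.
  have := @sqr_sum_weights R _ (index_enum 'I_M) (fun i => wt p M i (g s)) (fun i => k (tail i))
    (1 + eta).
  rewrite /dcross /Sq.
  under [X in _ -> _ -> _ -> X ^+ 2 <= _]eq_bigr do rewrite mulrC.
  under [X in _ -> _ -> _ -> _ <= _ * X]eq_bigr do rewrite mulrC.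
  apply; [by apply: ltr_wpDr => //; exact: eta0 | by move=> i; exact: wt_ge0 | exact: sum_wt_le].
rewrite int01Z // /Sq int01_sum; last by move=> i; exact: bmfZ.
have : \sum_(i < M) int01 (fun s => k (tail i) ^+ 2 * wt p M i (g s)) <=
    int01 (fun s => h s ^+ 2) + eta.
  apply: (@le_trans _ _ (\sum_(i < M) (k (tail i) ^+ 2 * (tail i - tail i.+1) + d ^+ 2))).
    apply: ler_sum => i _; rewrite int01Z //.
    have := wt_int01 i; rewrite ler_norml => /andP[_ hi].
    have /andP[k0 k1] := slope01 i.
    have kk : k (tail i) ^+ 2 <= 1 by rewrite expr_le1.
    have : 0 <= d ^+ 2 by exact: sqr_ge0.
    have : 0 <= k (tail i) ^+ 2 by exact: sqr_ge0.
    by nra.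
  rewrite big_split /= sum_d lerD2r.
  by apply: (lower_sum q); [exact: tail_itv | exact: tail_step].
have /andP[hh0 hh1] := quant_sqr_itv.
set hh := int01 (fun s => h s ^+ 2) in hh0 hh1 *; set w := \sum_(i < M) _.
have := eta0; have := eta1; clearbody hh w; rewrite -/eta; move: eta => e.
move=> e1 e0 wh.
have : (1 + e) * w <= (1 + e) * (hh + e) by rewrite ler_wpM2l //; lra.
have : e * hh <= e by rewrite ler_piMr.
have : e * e <= e by rewrite ler_piMr.
lra.
Qed.

(** Where the weight i is nonzero, g is at least i / M; its integral times [k (tail i)] is nearly H
    (tail i) - H (tail (i+1)), and summation by parts recovers [cross]. Each cell loses (1 + 4 L)
    d^2, and the boundary term H (tail 0) / M is one more eta. *)
Lemma cross_le_dcross : cross - (2 + 4 * L) * eta <= int01 (fun s => g s * dcross (g s)).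
Proof.
have L0 : 0 <= L := lip_ge0 q.
have bg := G0_bmf g.
rewrite (_ : (fun s => g s * _) =
    fun s => \sum_(i < M) k (tail i) * (wt p M i (g s) * g s)); last first.
  apply/funext => s; rewrite /dcross mulr_sumr; apply: eq_bigr => i _; ring.
rewrite int01_sum; last by move=> i; apply: bmfZ; exact: bmfM.
apply: (@le_trans _ _ (\sum_(i < M)
    (M%:R^-1 * (i%:R * (H (tail i) - H (tail i.+1))) - (1 + 4 * L) * d ^+ 2))).
  rewrite sumrB -(mulr_sumr _ _ _ (1 + 4 * L)) sum_d -mulr_sumr.
  rewrite (sum_index_diff (fun i => H (tail i))) tail_last (prim0 q : H 0 = 0).
  have /andP[_ ?] := prim_itv q (tail_itv 0).
  rewrite mulr0 subr0 addr0 /cross mulrBr.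
  have : M%:R^-1 * H (tail 0) <= eta.
    by apply: le_trans Mi_eta; rewrite ler_piMr // invr_ge0 ltW.
  by lra.
apply: ler_sum => i _; rewrite int01Z; last exact: bmfM.
have /andP[k0 k1] := slope01 i.
set c : R := i%:R / M%:R.
have c0 : 0 <= c by rewrite divr_ge0.
have c1 : c <= 1 by rewrite /c ler_pdivrMr // mul1r ler_nat ltnW.
have wc : c * int01 (fun s => wt p M i (g s)) <= int01 (fun s => wt p M i (g s) * g s).
  rewrite -int01Z //; apply: le_int01; [exact: bmfZ|exact: bmfM|].
  by move=> s _; rewrite mulrC; exact: wt_support.
have := wt_int01 i; rewrite ler_norml => /andP[hi _].
have := prim_quadratic q (tail i) (tail i.+1 - tail i).
rewrite (addrC (tail i)) subrK ler_norml -/H -/k -/L => /andP[hq _].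
have D0 := tail_step i; have D1 := tail_step_le i.
rewrite mulrA (mulrC _ i%:R) -/c.
set b := int01 (fun s => wt p M i (g s)) in wc hi *.
set D := tail i - tail i.+1 in hi D1 hq *.
have D0' : 0 <= D by rewrite subr_ge0.
(* Since d <= eta <= 1, the increment d + d^2 is at most 2 d. *)
have dd : (tail i.+1 - tail i) ^+ 2 <= 4 * d ^+ 2.
  have d2 : D <= 2 * d by apply: (le_trans D1); rewrite expr2 mulrDl mul1r lerD2l ler_piMr //; exact: le_trans d_eta eta1.
  rewrite (_ : tail i.+1 - tail i = - D); last by rewrite /D; ring.
  by rewrite sqrrN; nra.
have kb : H (tail i) - H (tail i.+1) - (1 + 4 * L) * d ^+ 2 <= k (tail i) * b.
  have : L * (tail i.+1 - tail i) ^+ 2 <= L * (4 * d ^+ 2) by rewrite ler_wpM2l.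
  have : k (tail i) * (D - d ^+ 2) <= k (tail i) * b by rewrite ler_wpM2l //; lra.
  have : k (tail i) * d ^+ 2 <= d ^+ 2 by rewrite ler_piMl ?sqr_ge0.
  move: hq; rewrite (_ : tail i.+1 - tail i = - D); last by rewrite /D; ring.
  by lra.
apply: (@le_trans _ _ (c * (k (tail i) * b))); last first.
  by rewrite mulrCA ler_wpM2l.
have : c * (H (tail i) - H (tail i.+1) - (1 + 4 * L) * d ^+ 2) <= c * (k (tail i) * b).
  by rewrite ler_wpM2l.
have : c * ((1 + 4 * L) * d ^+ 2) <= (1 + 4 * L) * d ^+ 2.
  by rewrite ler_piMl // mulr_ge0 ?sqr_ge0 //; lra.
by lra.
Qed.

(** The squared distance with its cross term smoothed. The added constant, 7 + 8 L = 3 + 2 (2 + 4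
    L), is what the two preceding estimates lose. *)
Definition sdist : R := int01 (fun s => g s ^+ 2) - 2 * cross
  + int01 (fun s => h s ^+ 2) + (7 + 8 * L) * eta.

(** The gradient of [sdist] is twice g - D, so this is the eikonal inequality |grad W|^2 <= 4 W,
    valid at every g without error. *)
Lemma grad_le_sdist : int01 (fun s => (g s - dcross (g s)) ^+ 2) <= sdist.
Proof.
have bg := G0_bmf g; have bd := dcross_bmf.
rewrite (_ : (fun _ => _) = fun s => g s ^+ 2 - 2 * (g s * dcross (g s)) + dcross (g s) ^+ 2);
  last by apply/funext => s; ring.
have b1 := bmf_sqr bg; have b2 := bmfM bg bd; have b3 := bmf_sqr bd.
rewrite int01D //; last by apply: bmfB => //; exact: bmfZ.
rewrite int01B //; last exact: bmfZ.
rewrite int01Z //.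
have := dcross_sqr; have := cross_le_dcross; rewrite /sdist; lra.
Qed.

(** The layer-cake formula for g, integrated against h. From below, the bathtub bound is applied to
    each smoothed level; from above, each smoothed tail is at most the measure of {g > i / M}, which
    is an upper interval. *)
Lemma cross_approx : `|cross - int01 (fun s => g s * h s)| <= 2 / p + M%:R^-1.
Proof.
have bg := G0_bmf g; have bh := quant_bmf q.
have Mi0 : 0 <= M%:R^-1 :> R by rewrite invr_ge0 ltW.
have p20 : 0 <= 2 / p by rewrite divr_ge0 // ltW.
have mean_le c : 0 <= c -> int01 (fun s => c * h s) <= c.
  move=> c0; rewrite -[leRHS](@int01_cst R).
  apply: le_int01; [exact: bmfZ|exact: bmf_cst|] => s _.
  by have /andP[? ?] := quant_itv q s; rewrite ler_piMr.
have bgh := bmfM bg bh.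
rewrite ler_norml; apply/andP; split.
  suff : int01 (fun s => g s * h s - (2 / p) * h s) <= cross.
    by rewrite int01B //; [have := mean_le _ p20; lra | exact: bmfZ].
  apply: (@le_trans _ _ (int01 (fun s => M%:R^-1 *
      \sum_(i < M) h s * tailc p M i (g s)))).
    have b : bmf (fun s => \sum_(i < M) h s * tailc p M i (g s)).
      by apply: bmf_sum => i; exact: bmfM.
    apply: le_int01; [by apply: bmfB => //; exact: bmfZ|exact: bmfZ|] => s _.
    have /andP[h0 _] := quant_itv q s; have /andP[_ g1] := G0_itv g s.
    have := sum_tailc_ge p1 M0 g1; rewrite -mulr_sumr => hs.
    have := ler_wpM2l h0 hs; rewrite -/h; lra.
  rewrite int01Z; last by apply: bmf_sum => i; exact: bmfM.
  rewrite int01_sum; last by move=> i; exact: bmfM.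
  apply: ler_wpM2l => //; apply: ler_sum => i _.
  by apply: bathtub => // s; exact: tailc_itv.
suff : cross <= int01 (fun s => g s * h s + M%:R^-1 * h s).
  by rewrite int01D //; [have := mean_le _ Mi0; lra | exact: bmfZ].
have bS i : bmf (fun s => (((i : 'I_M)%:R / M%:R < g s)%R)%:R : R).
  apply: (@nondecreasing_bmf _ _ 1) => [x y xy|x].
    rewrite ler_nat; case: (ltP (i%:R / M%:R) (g x)) => //= cx.
    by rewrite (lt_le_trans cx) // G0_homo.
  by case: (_ < _); rewrite ?normr1 ?normr0.
apply: (@le_trans _ _ (int01 (fun s => M%:R^-1 *
    \sum_(i < M) h s * ((i%:R / M%:R < g s)%R)%:R))); last first.
  have b : bmf (fun s => \sum_(i < M) h s * ((i%:R / M%:R < g s)%R)%:R).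
    by apply: bmf_sum => i; exact: bmfM.
  apply: le_int01; [exact: bmfZ|by apply: bmfD => //; exact: bmfZ|] => s _.
  have /andP[h0 _] := quant_itv q s; have /andP[g0 _] := G0_itv g s.
  have := sum_above_le M0 g0; rewrite -mulr_sumr => hs.
  have := ler_wpM2l h0 hs; rewrite -/h; lra.
rewrite int01Z; last by apply: bmf_sum => i; exact: bmfM.
rewrite int01_sum; last by move=> i; exact: bmfM.
apply: ler_wpM2l => //; apply: ler_sum => i _.
apply: prim_le_upper; [exact: G0_homo|exact: tail_itv|].
apply: le_int01 => // s _; case: ltP => gi /=.
  by have /andP[] := tailc_itv p M i (g s).
by rewrite /tailc bump_le0 // mulr_ge0_le0 ?(ltW p0) // subr_le0.
Qed.

Lemma sdist_approx : `|sdist - int01 (fun s => (g s - h s) ^+ 2)| <=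
  (7 + 8 * L) * eta + 2 * (2 / p + M%:R^-1).
Proof.
have bg := G0_bmf g; have bh := quant_bmf q.
rewrite (_ : (fun s => (g s - h s) ^+ 2) = fun s => g s ^+ 2 - 2 * (g s * h s) + h s ^+ 2);
  last by apply/funext => s; ring.
have b1 := bmf_sqr bg; have b2 := bmfM bg bh; have b3 := bmf_sqr bh.
rewrite int01D //; last by apply: bmfB => //; exact: bmfZ.
rewrite int01B //; last exact: bmfZ.
rewrite int01Z // /sdist.
have L0 : 0 <= (7 + 8 * L) * eta.
  by rewrite mulr_ge0 //; have : 0 <= L := lip_ge0 q; lra.
have := cross_approx; rewrite !ler_norml => /andP[? ?]; apply/andP; split; lra.
Qed.

End SmoothDistance.

(** * A finite net of quantile functions *)

Section Net.
Variable R : realType.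

Definition ramp (y : R) : R := relu y - relu (y - 1).
Definition iramp (y : R) : R := relu y ^+ 2 / 2 - relu (y - 1) ^+ 2 / 2.

Lemma iramp_quadratic y h : `|iramp (y + h) - iramp y - h * ramp y| <= h ^+ 2.
Proof.
have /andP[a0 a1] := relu_quadratic y h.
have /andP[b0 b1] := relu_quadratic (y - 1) h.
rewrite /iramp /ramp (addrAC y h) ler_norml; apply/andP; split; lra.
Qed.

Lemma ramp_lip x y : `|ramp x - ramp y| <= 2 * `|x - y|.
Proof.
have := relu_lip x y; have := relu_lip (x - 1) (y - 1); rewrite /ramp.
rewrite (_ : x - 1 - (y - 1) = x - y); last ring.
by rewrite !ler_norml => /andP[? ?] /andP[? ?]; apply/andP; split; lra.
Qed.

Lemma ramp_itv x : 0 <= ramp x <= 1.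
Proof.
rewrite /ramp !reluE; case: (leP 0 x) => ?; case: (leP 0 (x - 1)) => ?;
  apply/andP; split; lra.
Qed.

Lemma ramp_homo x y : x <= y -> ramp x <= ramp y.
Proof.
rewrite /ramp !reluE; case: (leP 0 x) => ?; case: (leP 0 (x - 1)) => ?;
case: (leP 0 y) => ?; case: (leP 0 (y - 1)) => ?; lra.
Qed.

Lemma ramp_le0 x : x <= 0 -> ramp x = 0.
Proof.
rewrite /ramp !reluE; case: (leP 0 x) => ?; case: (leP 0 (x - 1)) => ?; lra.
Qed.

Lemma ramp_ge1 x : 1 <= x -> ramp x = 1.
Proof.
rewrite /ramp !reluE; case: (leP 0 x) => ?; case: (leP 0 (x - 1)) => ?; lra.
Qed.

(** The sum is the piecewise linear function on the grid of mesh 1 / K that starts at 0 and rises by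
    w_i on cell i. *)
Lemma ramp_profile (K : nat) (w : 'I_K -> R) : (0 < K)%N ->
  (forall i, 0 <= w i) -> \sum_i w i <= 1 ->
  exists q : profile R, forall s, quant q s = \sum_i w i * ramp (K%:R * s - i%:R).
Proof.
move=> K0 w0 w1; have K0' : 0 < K%:R :> R by rewrite ltr0n.
(* A termwise primitive of k, with the value at 0 subtracted so that F 0 = 0. *)
pose F x := - \sum_i w i / K%:R *
  (iramp (K%:R * (1 - x) - i%:R) - iramp (K%:R * (1 - 0) - i%:R)).
pose k x := \sum_i w i * ramp (K%:R * (1 - x) - i%:R).
have l0 : 0 <= 2 * K%:R :> R by rewrite mulr_ge0.
have sumC C : 0 <= C -> \sum_i w i * C <= C by move=> ?; rewrite -mulr_suml ler_piMl.
have Fq x h : `|F (x + h) - F x - h * k x| <= 2 * K%:R * h ^+ 2.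
  rewrite (_ : _ - _ = \sum_i - (w i / K%:R) * (iramp (K%:R * (1 - x) - i%:R + - (K%:R * h))
    - iramp (K%:R * (1 - x) - i%:R) - - (K%:R * h) * ramp (K%:R * (1 - x) - i%:R))).
    apply: le_trans (ler_norm_sum _ _ _) _.
    apply: (@le_trans _ _ (\sum_i w i * (K%:R * h ^+ 2))).
      apply: ler_sum => i _; rewrite normrM normrN normrM normfV (gtr0_norm K0').
      rewrite (ger0_norm (w0 i)) -mulrA ler_wpM2l // mulrC ler_pdivrMr //.
      apply: le_trans (iramp_quadratic _ _) _.
      by rewrite sqrrN exprMn expr2 -mulrA mulrC.
    apply: le_trans (sumC _ _) _; first by rewrite mulr_ge0 ?sqr_ge0 // ltW.
    by rewrite -mulrA ler_peMl ?ler1n // mulr_ge0 ?sqr_ge0 // ltW.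
  rewrite /F /k mulr_sumr -!sumrN -!big_split /=; apply: eq_bigr => i _.
  rewrite (_ : K%:R * (1 - (x + h)) - i%:R = K%:R * (1 - x) - i%:R + - (K%:R * h)); last ring.
  by field; rewrite gt_eqF.
have kl x y : `|k x - k y| <= 2 * K%:R * `|x - y|.
  rewrite -sumrB; apply: le_trans (ler_norm_sum _ _ _) _.
  apply: (@le_trans _ _ (\sum_i w i * (2 * K%:R * `|x - y|))).
    apply: ler_sum => i _; rewrite -mulrBr normrM (ger0_norm (w0 i)) ler_wpM2l //.
    apply: le_trans (ramp_lip _ _) _; rewrite -mulrA ler_wpM2l //.
    rewrite (_ : K%:R * (1 - x) - i%:R - (K%:R * (1 - y) - i%:R) = K%:R * (y - x)); last ring.
    by rewrite normrM (gtr0_norm K0') distrC.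
  by apply: sumC; rewrite mulr_ge0.
have kni x y : x <= y -> k y <= k x.
  move=> xy; apply: ler_sum => i _; rewrite ler_wpM2l // ramp_homo //.
  by rewrite lerD2r ler_wpM2l ?(ltW K0') // lerD2l lerN2.
have k01 x : 0 <= k x <= 1.
  apply/andP; split.
    by apply: sumr_ge0 => i _; rewrite mulr_ge0 //; have /andP[] := ramp_itv (K%:R * (1 - x) - i%:R).
  apply: le_trans w1; apply: ler_sum => i _; rewrite ler_piMr //.
  by have /andP[] := ramp_itv (K%:R * (1 - x) - i%:R).
have F0 : F 0 = 0 by rewrite /F big1 ?oppr0 // => i _; rewrite subrr mulr0.
exists (@Profile R F k (2 * K%:R) l0 Fq kl kni k01 F0) => s.
rewrite /quant /= /k; apply: eq_bigr => i _; rewrite (_ : 1 - (1 - s) = s) //; ring.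
Qed.

(** The grid cells are ]j/K, (j+1)/K], so 0 belongs to none of them. *)
Lemma le_int01_oc (f g : R -> R) : bmf f -> bmf g ->
  (forall x, 0 < x <= 1 -> f x <= g x) -> int01 f <= int01 g.
Proof.
move=> bf bg fg.
have key (f' : R -> R) : bmf f' -> int01 f' = int01 (fun s => f' s * ((1 - 1 < s)%R)%:R).
  by move=> b; rewrite int01_restr ?ler01 ?lexx // subrr.
have bI := bmf_gt (1 - 1 : R).
rewrite key // (key g) //; apply: le_int01; [exact: bmfM|exact: bmfM|].
move=> x /andP[x0 x1]; rewrite subrr; case: (ltP 0 x) => xp; last by rewrite !mulr0.
by rewrite !mulr1 fg // xp.
Qed.

Lemma grid_cell (K : nat) (s : R) : (0 < K)%N -> 0 < s <= 1 ->
  exists2 j : nat, (j < K)%N & j%:R < K%:R * s <= j.+1%:R.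
Proof.
move=> K0 /andP[s0 s1]; have K0' : 0 < K%:R :> R by rewrite ltr0n.
have ex : exists n, K%:R * s <= n.+1%:R.
  by exists K.-1; rewrite prednK // ler_piMr // ltW.
exists (ex_minn ex); case: ex_minnP => j js jmin.
  by rewrite -(prednK K0) ltnS; apply: jmin; rewrite prednK // ler_piMr // ltW.
rewrite js andbT; case: j js jmin => [|j] js jmin; first by rewrite mulr_gt0.
by rewrite ltNge; apply/negP => /jmin; rewrite ltnn.
Qed.

(** Values of g on the grid are rounded down to multiples of 1 / K and interpolated with a lag of
    one cell, so that h <= g. As 0 <= g - h <= 1, the squared error is at most g - h, which on cell
    j is bounded by an increment of g over two cells plus 1 / K; these sum to at most 3. *)
Lemma ramp_approx (g : G0 R) (K : nat) : (0 < K)%N ->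
  exists f : {ffun 'I_K -> 'I_K.+1}, (\sum_i f i <= K)%N /\
  let h s := \sum_i ((f i)%:R / K%:R) * ramp (K%:R * s - i%:R) in
  int01 (fun s => (g s - h s) ^+ 2) <= 3 / K%:R.
Proof.
move=> K0; have K0' : 0 < K%:R :> R by rewrite ltr0n.
(* The shifted index produces the lag: G (j+1) is the value at the left end of cell j, and G 0 = 0
   makes h start at 0. *)
pose G j := if j is i.+1 then g (i%:R / K%:R) else 0.
pose Q j := if j is i.+1 then Num.truncn (K%:R * g (i%:R / K%:R)) else 0%N.
have G0 j : 0 <= G j <= 1 by case: j => [|j] /=; [rewrite lexx ler01|exact: G0_itv].
have GS j : G j <= G j.+1.
  case: j => [|j] /=; first by have /andP[] := G0_itv g (0%:R / K%:R).
  by apply: G0_homo; rewrite ler_pM2r ?invr_gt0 // ler_nat.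
have KG j : 0 <= K%:R * G j by rewrite mulr_ge0 ?(ltW K0') //; have /andP[] := G0 j.
have QE j : Q j = Num.truncn (K%:R * G j) by case: j => [|j] //=; rewrite mulr0 truncn0.
have QS j : (Q j <= Q j.+1)%N by rewrite !QE; apply: le_truncn; rewrite ler_pM2l.
have Q1 j : (Q j)%:R / K%:R <= G j by rewrite QE ler_pdivrMr // (mulrC (G j)) truncn_le.
have Q2 j : G j - K%:R^-1 <= (Q j)%:R / K%:R.
  rewrite ler_pdivlMr // mulrBl mulVf ?gt_eqF // lerBlDr mulrC natr1 QE ltW //.
  exact: truncnS_gt.
have QK j : (Q j <= K)%N.
  rewrite -(ler_nat R); apply: le_trans (_ : K%:R * G j <= _); first by rewrite QE truncn_le.
  by rewrite ler_piMr ?(ltW K0') //; have /andP[] := G0 j.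
(* [inord] never falls back to its default here, because Q is bounded by K. *)
pose f := [ffun i : 'I_K => inord (Q i.+1 - Q i) : 'I_K.+1].
have fE i : f i = (Q i.+1 - Q i)%N :> nat.
  by rewrite ffunE inordK // ltnS (leq_trans (leq_subr _ _)).
have fsum n : (\sum_(i < n) (Q i.+1 - Q i) = Q n)%N.
  elim: n => [|n IH]; first by rewrite big_ord0.
  by rewrite big_ord_recr /= IH subnKC.
exists f; split; first by rewrite (eq_bigr _ (fun i _ => fE i)) fsum.
set h := fun s => _; rewrite /=.
have fR (i : 'I_K) : (f i)%:R = (Q i.+1)%:R - (Q i)%:R :> R by rewrite fE natrB.
(* On cell j the ramps of index below j are complete and those above j have not started, so h lies
   between two consecutive partial sums. *)
have hb j s : (j < K)%N -> j%:R < K%:R * s <= j.+1%:R ->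
    (Q j)%:R / K%:R <= h s <= (Q j.+1)%:R / K%:R.
  move=> jK /andP[js sj].
  have tele n : (n <= K)%N ->
      \sum_(i < K) ((f i)%:R / K%:R) * (i < n)%N%:R = (Q n)%:R / K%:R :> R.
    move=> nK; under eq_bigr do rewrite mulr_natr mulrb.
    rewrite -big_mkcond /= (eq_bigr (fun i : 'I_K => ((Q i.+1)%:R - (Q i)%:R) / K%:R));
      last by move=> i _; rewrite fR.
    rewrite -(big_ord_widen _ (fun i => ((Q i.+1)%:R - (Q i)%:R) / K%:R) nK).
    rewrite -(big_mkord xpredT (fun i => ((Q i.+1)%:R - (Q i)%:R) / K%:R)).
    rewrite (telescope_sumr_eq (fun i => (Q i)%:R / K%:R)) //=; first by rewrite mul0r subr0.
    by move=> i _; ring.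
  rewrite -!tele //; last exact: ltnW.
  apply/andP; split; apply: ler_sum => i _; rewrite ler_wpM2l ?divr_ge0 ?(ltW K0') //.
    case: ltnP => ij /=; last by have /andP[] := ramp_itv (K%:R * s - i%:R).
    rewrite ramp_ge1 // lerBrDr addrC natr1 (le_trans _ (ltW js)) //.
    by rewrite ler_nat.
  case: ltnP => ij /=; first by have /andP[] := ramp_itv (K%:R * s - i%:R).
  by rewrite ramp_le0 // subr_le0 (le_trans sj) // ler_nat.
pose c (j : nat) := G j.+2 - G j + K%:R^-1.
have c0 j : 0 <= c j.
  have : 0 <= K%:R^-1 :> R by rewrite invr_ge0 ltW.
  by have := GS j; have := GS j.+1; rewrite /c; lra.
(* The indicator of s > a / K, in the form whose integral is known. *)
pose I (a : nat) (s : R) : R := ((1 - (1 - a%:R / K%:R) < s)%R)%:R.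
have bI a : bmf (I a) by exact: bmf_gt.
have IE a s : I a s = (a%:R < K%:R * s)%R%:R.
  by rewrite /I (_ : 1 - (1 - a%:R / K%:R) = a%:R / K%:R); [rewrite ltr_pdivrMr // mulrC|ring].
have bh : bmf h.
  apply: bmf_sum => i; apply: bmfZ; apply: (@nondecreasing_bmf _ _ 1) => [x y xy|x].
    by apply: ramp_homo; rewrite lerD2r ler_pM2l.
  by have /andP[? ?] := ramp_itv (K%:R * x - i%:R); rewrite ger0_norm.
apply: (@le_trans _ _ (int01 (fun s => \sum_(j < K) c j * (I j s - I j.+1 s)))).
  apply: le_int01_oc.
  - by apply: bmf_sqr; apply: bmfB => //; exact: G0_bmf.
  - by apply: bmf_sum => j; apply: bmfZ; exact: bmfB.
  move=> s s01; have [j jK js] := grid_cell K0 s01.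
  have /andP[h1 h2] := hb j s jK js.
  have gs1 : G j.+1 <= g s.
    by apply: G0_homo; rewrite ler_pdivrMr // mulrC ltW //; case/andP: js.
  have gs2 : g s <= G j.+2.
    by apply: G0_homo; rewrite ler_pdivlMr // mulrC; case/andP: js.
  have gh0 : 0 <= g s - h s by have := Q1 j.+1; lra.
  have gh1 : g s - h s <= 1.
    have /andP[_ ?] := G0_itv g s; have : 0 <= (Q j)%:R / K%:R :> R by rewrite divr_ge0 // ltW.
    lra.
  apply: (@le_trans _ _ (g s - h s)); first by rewrite expr2 ler_piMl.
  apply: (@le_trans _ _ (c j)); first by have := Q2 j; rewrite /c; lra.
  rewrite (bigD1 (Ordinal jK)) //= !IE; case/andP: js => -> js.
  rewrite ltNge js /= subr0 mulr1 lerDl; apply: sumr_ge0 => i _.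
  rewrite mulr_ge0 // subr_ge0 !IE ler_nat.
  by case: (ltP i.+1%:R (K%:R * s)) => // is_; rewrite (lt_trans _ is_) // ltr_nat.
rewrite int01_sum; last by move=> j; apply: bmfZ; exact: bmfB.
rewrite (eq_bigr (fun j : 'I_K => c j / K%:R)); last first.
  move=> j _; rewrite int01Z; last exact: bmfB.
  rewrite int01B // !int01_gt; first by rewrite -natr1; congr (_ * _); ring.
    by rewrite lerBrDl addr0 gerBl divr_ge0 ?(ltW K0') // ler_pdivrMr // mul1r ler_nat ltn_ord.
  by rewrite lerBrDl addr0 gerBl divr_ge0 ?(ltW K0') // ler_pdivrMr // mul1r ler_nat ltnW.
rewrite -mulr_suml ler_pM2r ?invr_gt0 // /c big_split /= sumr_const card_ord.
rewrite -[K%:R^-1 *+ K]mulr_natr mulVf ?gt_eqF //.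
rewrite -(big_mkord xpredT (fun j => G j.+2 - G j)).
rewrite (telescope_sumr_eq (fun j => G j + G j.+1)) //; last by move=> j _; ring.
have /andP[? ?] := G0 K; have /andP[? ?] := G0 K.+1; have /andP[? ?] := G0 1%N.
by rewrite [G 0%N]/G; lra.
Qed.

(** The approximants of mesh 1 / K are described by K integers between 0 and K, so they form a
    finite family. *)
Lemma profile_net (e : R) : 0 < e ->
  exists (I : finType) (Q : I -> profile R), forall g : G0 R,
    exists i, int01 (fun s => (g s - quant (Q i) s) ^+ 2) <= e.
Proof.
move=> e0; have [K K0 Ke] : exists2 K : nat, (0 < K)%N & 3 / K%:R <= e.
  exists (Num.truncn (3 / e)).+1 => //.
  by rewrite ler_pdivrMr // mulrC -ler_pdivrMr // ltW // truncnS_gt.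
have K0' : 0 < K%:R :> R by rewrite ltr0n.
have ex (f : {ffun 'I_K -> 'I_K.+1}) : exists q : profile R, (\sum_i f i <= K)%N ->
    forall s, quant q s = \sum_i ((f i)%:R / K%:R) * ramp (K%:R * s - i%:R).
  case: (leqP (\sum_i f i) K) => fK.
    have [] := @ramp_profile K (fun i => (f i)%:R / K%:R) K0.
    - by move=> i; rewrite divr_ge0 // ltW.
    - by rewrite -mulr_suml ler_pdivrMr // mul1r -natr_sum ler_nat.
    by move=> q qE; exists q.
  (* An index whose increments exceed total height 1 gets the zero profile; no approximant has such
     an index. *)
  have [] := @ramp_profile K (fun=> 0) K0; [by []|by rewrite big1 ?ler01|].
  by move=> q _; exists q.
have [Q QE] := choice ex.
exists {ffun 'I_K -> 'I_K.+1}, Q => g.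
have [f [fK fg]] := ramp_approx g K0; exists f.
apply: le_trans Ke; apply: le_trans fg; rewrite le_eqVlt; apply/orP; left; apply/eqP.
by apply: eq_int01 => s _; rewrite QE.
Qed.

End Net.

(** * Cylinder functions *)

Section Measurability.
Variable R : realType.

Lemma measurable_eval_at (t : R) : measurable_fun setT (fun g : G0m R => G0fun g t).
Proof.
move=> _ A mA; rewrite setTI; apply: sub_sigma_algebra.
by exists t, A.
Qed.

(** For monotone right continuous g, g t < x holds exactly when g r < x for some rational r > t. The
    event is thus a countable union of measurable rectangles. *)
Lemma measurable_eval :
  measurable_fun setT (fun p : G0m R * R => G0fun p.1 p.2).
Proof.
apply: (measurability _ (RGenInftyO.measurableE R)) => /= _ [_ [x ->]] <-.
rewrite setTI (_ : _ @^-1` _ = \bigcup_(r : rat)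
   ((fun g : G0m R => G0fun g (ratr r)) @^-1` `]-oo, x[%classic `*` `]-oo, ratr r[%classic)).
  apply: bigcupT_measurable_rat => r; apply: measurableX; last exact: measurable_itv.
  rewrite -[X in measurable X]setTI; apply: measurable_eval_at => //; exact: measurable_itv.
apply/seteqP; split => [[g t]|[g t] [r _]] /=; rewrite !in_itv /=; last first.
  by move=> [gr tr]; apply: le_lt_trans gr; apply: G0_homo; exact: ltW.
move=> gx.
have [g0 g1 _ _ gr] := G0P g.
have : \forall y \near t^'+, g y < x.
  have [t0|t0] := ltP t 0.
    near=> y; rewrite g0; first by rewrite -(g0 _ t0).
    by near: y; exact: nbhs_right_lt.
  have [t1|t1] := ltP t 1; last first.
    near=> y; rewrite g1; first by rewrite -(g1 _ t1).
    by apply: le_trans t1 _; near: y; exact: nbhs_right_ge.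
  have /cvgrPdist_lt := gr t t0 t1; move/(_ (x - g t)); rewrite subr_gt0 => /(_ gx).
  apply: filterS => y; rewrite ltr_distlC => /andP[_]; rewrite addrCA subrr addr0; exact.
move=> [e /= e0 gy].
have [r] := @rat_in_itvoo R t (t + e) ltac:(by rewrite ltrDl).
rewrite in_itv /= => /andP[tr rt]; exists r => //=; rewrite !in_itv /=; split => //.
by apply: gy => //=; rewrite ltr_distlC; apply/andP; split; lra.
Unshelve. all: by end_near.
Qed.

Lemma measurable_integral01 (f : G0m R * R -> \bar R) : measurable_fun setT f ->
  (forall z, 0 <= f z)%E ->
  measurable_fun setT (fun g => \int[@lebesgue_measure R]_(t in `[0%R, 1%R]) f (g, t))%E.
Proof.
move=> mf f0.
pose f' (z : G0m R * R) := (f z * (\1_(`[0%R, 1%R]%classic) z.2)%:E)%E.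
have mf' : measurable_fun setT f'.
  apply: emeasurable_funM => //; apply/measurable_EFinP.
  apply: measurableT_comp; last exact: measurable_snd.
  by apply: measurable_indic; exact: measurable_itv.
have f'0 z : (0 <= f' z)%E by rewrite mule_ge0 // lee_fin.
have := measurable_fun_fubini_tonelli_F (m2 := @lebesgue_measure R) f' mf' f'0.
apply: eq_measurable_fun => g _; rewrite [RHS]integral_mkcond /fubini_F.
apply: eq_integral => t _; rewrite /f' /= patchE indicE.
by case: ifPn => _; rewrite ?mule1 ?mule0.
Qed.

Lemma measurable_moment (a : R -> R) : continuous a -> (forall x, 0 <= x <= 1 -> 0 <= a x) ->
  measurable_fun setT (fun g : G0m R => int01 (fun s => a (G0fun g s))).
Proof.
move=> ca a0; rewrite /int01; apply: measurableT_comp => //.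
apply: (@measurable_integral01 (fun z => (a (G0fun z.1 z.2))%:E)).
  apply/measurable_EFinP; apply: measurableT_comp; last exact: measurable_eval.
  exact: continuous_measurable_fun.
by move=> z; rewrite lee_fin a0 // G0_itv.
Qed.

End Measurability.

(** * Sums and compositions of C^1 functions of finitely many moments *)

Section Cylinder.
Variables (R : realType) (m : nat) (a a' : 'I_m -> R -> R).
Hypothesis da : forall i (x : R), is_derive x 1 (a i) (a' i x).
Hypothesis ca' : forall i, continuous (a' i : R -> R).

Definition moments (g : G0 R) : 'rV[R]_m := \row_i int01 (fun s => a i (g s)).

(** U is a C^1 function with partial derivatives D. Measurability along the moment map is carried as
    part of the invariant, so each operation below preserves it directly. *)
Definition cyl (U : 'rV[R]_m -> R) (D : 'I_m -> 'rV[R]_m -> R) :=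
  [/\ continuous U,
      forall i x, is_derive (0 : R) 1 (fun s : R => U (x + s *: delta_mx 0 i)) (D i x),
      forall i, continuous (D i),
      measurable_fun setT (fun g : G0m R => U (moments g)) &
      forall i, measurable_fun setT (fun g : G0m R => D i (moments g))].

Definition cylgrad (D : 'I_m -> 'rV[R]_m -> R) (g : G0 R) (x : R) : R :=
  \sum_i D i (moments g) * a' i x.

Lemma cyl_cst c : cyl (fun=> c) (fun _ _ => 0).
Proof.
split=> [|i x|i||i].
- exact: cst_continuous.
- exact: is_derive_cst.
- exact: cst_continuous.
- exact: measurable_cst.
- exact: measurable_cst.
Qed.

Lemma cyl_coord j : measurable_fun setT (fun g : G0m R => int01 (fun s => a j (G0fun g s))) ->
  cyl (fun x => x 0 j) (fun i _ => (i == j)%:R).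
Proof.
move=> mj; split=> [|i x|i||i].
- exact: coord_continuous.
- apply: (@is_derive_quadratic _ _ _ _ 0) => h; rewrite mul0r !mxE eqxx /= normr_le0.
  by rewrite (eq_sym j); apply/eqP; ring.
- exact: cst_continuous.
- by apply: eq_measurable_fun mj => g _; rewrite mxE.
- exact: measurable_cst.
Qed.

Lemma cyl_add U V D E : cyl U D -> cyl V E ->
  cyl (fun x => U x + V x) (fun i x => D i x + E i x).
Proof.
move=> [cU dU cD mU mD] [cV dV cE mV mE]; split=> [x|i x|i x||i].
- exact: (cvgD (cU x) (cV x)).
- exact: is_deriveD.
- exact: (cvgD (cD i x) (cE i x)).
- exact: measurable_funD.
- exact: measurable_funD.
Qed.

(** Differentiability is asked only at values of U, so the rule applies to [ln] after a positive
    U. *)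
Lemma cyl_comp U D (phi phi' : R -> R) : cyl U D ->
  measurable_fun setT phi -> measurable_fun setT phi' ->
  (forall x, is_derive (U x) 1 phi (phi' (U x))) ->
  (forall x, {for U x, continuous phi'}) ->
  cyl (fun x => phi (U x)) (fun i x => phi' (U x) * D i x).
Proof.
move=> [cU dU cD mU mD] mp mp' dp cp'; split=> [x|i x|i x||i].
- apply: (@continuous_comp _ _ _ U phi); first exact: cU.
  apply: differentiable_continuous; apply/derivable1_diffP.
  by have [] := dp x.
- apply: is_derive1_comp => //; rewrite scale0r addr0; exact: dp.
- exact: (cvgM (@continuous_comp _ _ _ U phi' x (cU x) (cp' x)) (cD i x)).
- exact: measurableT_comp.
- by apply: measurable_funM => //; exact: measurableT_comp.
Qed.

Lemma cyl_sum (I : Type) (r : seq I) (U : I -> 'rV[R]_m -> R) D :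
  (forall k, cyl (U k) (D k)) ->
  cyl (fun x => \sum_(k <- r) U k x) (fun i x => \sum_(k <- r) D k i x).
Proof.
move=> cU; elim: r => [|k r IH].
  have -> : (fun x => \sum_(k <- [::]) U k x) = fun=> 0.
    by apply/funext => x; rewrite big_nil.
  have -> : (fun i x => \sum_(k <- [::]) D k i x) = (fun _ _ => 0).
    by apply/funext => i; apply/funext => x; rewrite big_nil.
  exact: cyl_cst.
have -> : (fun x => \sum_(k <- k :: r) U k x) = (fun x => U k x + \sum_(k <- r) U k x).
  by apply/funext => x; rewrite big_cons.
have -> : (fun i x => \sum_(k <- k :: r) D k i x) =
    (fun i x => D k i x + \sum_(k <- r) D k i x).
  by apply/funext => i; apply/funext => x; rewrite big_cons.
exact: cyl_add.
Qed.

Lemma cyl_scale c U D : cyl U D -> cyl (fun x => c * U x) (fun i x => c * D i x).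
Proof.
move=> cU; apply: (@cyl_comp U D ( *%R c) (fun=> c)) => //.
- move=> x; apply: (@is_derive_quadratic _ _ _ _ 0) => h; rewrite mul0r normr_le0.
  by apply/eqP; ring.
- by move=> x; exact: cvg_cst.
Qed.

Lemma cylgrad_coord j g x : cylgrad (fun i _ => (i == j)%:R) g x = a' j x.
Proof.
rewrite /cylgrad (bigD1 j) //= eqxx mul1r big1 ?addr0 // => i /negbTE ->.
by rewrite mul0r.
Qed.

Lemma cylgrad_add D E g x :
  cylgrad (fun i x => D i x + E i x) g x = cylgrad D g x + cylgrad E g x.
Proof. by rewrite /cylgrad -big_split; apply: eq_bigr => i _; rewrite mulrDl. Qed.

Lemma cylgrad_comp (c : 'rV[R]_m -> R) D g x :
  cylgrad (fun i x => c x * D i x) g x = c (moments g) * cylgrad D g x.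
Proof. by rewrite /cylgrad mulr_sumr; apply: eq_bigr => i _; rewrite mulrA. Qed.

Lemma cylgrad_sum (I : Type) (r : seq I) (D : I -> 'I_m -> 'rV[R]_m -> R) g x :
  cylgrad (fun i x => \sum_(k <- r) D k i x) g x = \sum_(k <- r) cylgrad (D k) g x.
Proof.
rewrite /cylgrad exchange_big; apply: eq_bigr => i _ /=.
by rewrite mulr_suml.
Qed.

Lemma cyl_Z1data U D : cyl U D -> exists z : Z1data R,
  [/\ forall g, z_fun z g = U (moments g),
      forall g t, z_grad z g t = cylgrad D g (G0fun g t),
      measurable_fun setT (fun g : G0m R => z_fun z g) &
      measurable_fun setT (fun p : G0m R * R => z_grad z p.1 p.2)].
Proof.
move=> [cU dU cD mU mD].
have UC1 : C1_Rm U.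
  move=> i; split => [x|]; first by have [] := dU i x.
  rewrite (_ : partial U i = D i); first exact: cD.
  by apply/funext => x; rewrite /partial derive1E; have [_ ->] := dU i x.
have a'E i : derive1 (a i) = a' i.
  by apply/funext => x; rewrite derive1E; have [_ ->] := da i x.
have aC1 i : C1_R (a i).
  split => [x|]; first by have [] := da i x.
  by rewrite a'E; exact: ca'.
pose z := MkZ1 UC1 aC1.
have gradE g t : z_grad z g t = cylgrad D g (G0fun g t).
  rewrite /z_grad /cylgrad; apply: eq_bigr => i _; rewrite /= a'E; congr (_ * _).
  by rewrite /partial derive1E; have [_ ->] := dU i (moments g).
exists z; split => //.
rewrite (_ : (fun p : G0m R * R => _) = fun p : G0m R * R =>
    \sum_i D i (moments p.1) * a' i (G0fun p.1 p.2)); last first.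
  by apply/funext => p; rewrite gradE.
apply: measurable_sum => i; apply: measurable_funM.
  by apply: (measurableT_comp (mD i)); exact: measurable_fst.
apply: (measurableT_comp (continuous_measurable_fun (@ca' i))).
exact: measurable_eval.
Qed.

End Cylinder.

(** * Smooth square root and soft minimum *)

Section QuantG0.
Variables (R : realType) (q : profile R).

(** Imposes the convention of G_0 outside [0,1[, possibly with a jump at 1. *)
Definition quant_ext (s : R) : R := if s < 0 then 0 else if s < 1 then quant q s else 1.

Lemma quant_ext_G0 : isG0 quant_ext.
Proof.
rewrite /quant_ext; split.
- by move=> t ->.
- by move=> t t1; rewrite !ifF //; apply/negbTE; rewrite -leNgt // (le_trans _ t1).
- move=> t t0 ->; rewrite ifF; first exact: quant_itv.
  by apply/negbTE; rewrite -leNgt.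
- move=> s t s0 st t1; have t0 := le_trans s0 st.
  rewrite t1 (le_lt_trans st t1) !ifF; try by apply/negbTE; rewrite -leNgt.
  by apply: slope_ni; rewrite lerD2l lerN2.
move=> t t0 t1; rewrite t1 ifF; last by apply/negbTE; rewrite -leNgt.
have : quant q x @[x --> t^'+] --> quant q t by exact/cvg_at_right_filter/quant_continuous.
apply: cvg_trans; apply: near_eq_cvg; near=> x.
have tx : t < x by near: x; exact: nbhs_right_gt.
rewrite ifF; last by apply/negbTE; rewrite -leNgt (le_trans t0) // ltW.
by rewrite ifT //; near: x; exact: nbhs_right_lt.
Unshelve. all: by end_near.
Qed.

Definition quant_G0 : G0 R := MkG0 quant_ext_G0.

Lemma int01_quant_G0 (g : G0 R) :
  int01 (fun s => (g s - quant_G0 s) ^+ 2) = int01 (fun s => (g s - quant q s) ^+ 2).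
Proof.
have bg := G0_bmf g; have bh := quant_bmf q; have bG := G0_bmf quant_G0.
apply: eq_int01_co; [exact/bmf_sqr/bmfB|exact/bmf_sqr/bmfB|] => x /andP[x0 x1].
by rewrite /= /quant_ext x1 ifF //; apply/negbTE; rewrite -leNgt.
Qed.

End QuantG0.

Section SmoothSqrt.
Variables (R : realType) (d : R).
Hypothesis d0 : 0 < d.

(* Approximates [Num.sqrt] on [0, +oo[, but is C^1 on the whole line: [z_U] must
   be C^1 on all of R^m, where nothing keeps its argument nonnegative. *)
Definition ssqrt (w : R) : R := Num.sqrt (Num.sqrt (w ^+ 2 + d ^+ 2)).
Definition dssqrt (w : R) : R := w / (2 * Num.sqrt (w ^+ 2 + d ^+ 2) * ssqrt w).

Let t w : R := Num.sqrt (w ^+ 2 + d ^+ 2).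

Let wd0 w : 0 < w ^+ 2 + d ^+ 2.
Proof. by rewrite ltr_wpDl ?sqr_ge0 // exprn_gt0. Qed.

Let t0 w : 0 < t w. Proof. by rewrite sqrtr_gt0. Qed.

Let t2 w : t w ^+ 2 = w ^+ 2 + d ^+ 2. Proof. by rewrite sqr_sqrtr // ltW. Qed.

Let s0 w : 0 < ssqrt w. Proof. by rewrite /ssqrt sqrtr_gt0; exact: t0. Qed.

Let s2 w : ssqrt w ^+ 2 = t w. Proof. by rewrite sqr_sqrtr // ltW. Qed.

Lemma is_derive_ssqrt (w : R) : is_derive w 1 ssqrt (dssqrt w).
Proof.
have h1 : is_derive w 1 (fun w => w ^+ 2 + d ^+ 2 : R) (2 * w).
  apply: (@is_derive_quadratic _ _ _ _ 1) => h.
  rewrite (_ : _ - _ = h ^+ 2); last ring.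
  by rewrite mul1r ger0_norm // sqr_ge0.
have h2 := @is_derive1_comp _ Num.sqrt _ w _ _ (is_derive1_sqrt (wd0 w)) h1.
have := @is_derive1_comp _ Num.sqrt t w _ _ (is_derive1_sqrt (t0 w)) h2.
rewrite (_ : _ * _ = dssqrt w) //.
change ((2 * ssqrt w)^-1 * ((2 * t w)^-1 * (2 * w)) = w / (2 * t w * ssqrt w)).
by have := t0 w; have := s0 w => ? ?; field; rewrite !gt_eqF.
Qed.

Lemma ssqrt_continuous : continuous ssqrt.
Proof.
move=> w; apply: differentiable_continuous; apply/derivable1_diffP.
by have [] := is_derive_ssqrt w.
Qed.

Lemma dssqrt_continuous : continuous dssqrt.
Proof.
have ct : continuous t.
  move=> w; apply: continuous_comp; last exact: sqrt_continuous.
  by apply: cvgD; [exact: exprn_continuous | exact: cvg_cst].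
move=> w; apply: cvgM; first exact: cvg_id.
apply: cvgV; first by rewrite gt_eqF // !mulr_gt0 //; exact: t0.
apply: cvgM; last exact: ssqrt_continuous.
by apply: cvgM; [exact: cvg_cst | exact: ct].
Qed.

Let wt w : 0 <= w -> w <= t w.
Proof.
move=> w0; rewrite -(@ler_pXn2r _ 2) ?nnegrE ?(ltW (t0 w)) // t2 lerDl.
exact: sqr_ge0.
Qed.

(** With t = sqrt (w^2 + d^2) the left side is w^2 E / t^3, and both w and E are at most t. Here E
    stands for the squared norm of g - D and w for W. *)
Lemma dssqrt_le1 w E : 0 <= E <= w -> (2 * dssqrt w) ^+ 2 * E <= 1.
Proof.
move=> /andP[E0 Ew]; have w0 : 0 <= w := le_trans E0 Ew.
have tw := wt w0.
rewrite (_ : _ * E = w ^+ 2 * E / (t w ^+ 2 * ssqrt w ^+ 2)); last first.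
  rewrite /dssqrt -/(t w); have := t0 w; have := s0 w => ? ?; field.
  by rewrite !gt_eqF.
rewrite s2 ler_pdivrMr ?mulr_gt0 ?exprn_gt0 // mul1r.
apply: ler_pM => //; first exact: sqr_ge0; last exact: le_trans Ew tw.
by rewrite ler_pXn2r ?nnegrE ?(ltW (t0 w)).
Qed.

Lemma sqrt_subadd (a b : R) : 0 <= a -> 0 <= b ->
  Num.sqrt (a + b) <= Num.sqrt a + Num.sqrt b.
Proof.
move=> a0 b0; rewrite -(@ler_pXn2r _ 2) ?nnegrE ?addr_ge0 ?sqrtr_ge0 //.
rewrite sqrrD !sqr_sqrtr ?addr_ge0 //.
have : 0 <= Num.sqrt a * Num.sqrt b by rewrite mulr_ge0 ?sqrtr_ge0.
by lra.
Qed.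

Lemma ssqrt_ge w D e : 0 <= w -> 0 <= e -> D <= w + e ->
  Num.sqrt D <= ssqrt w + Num.sqrt e.
Proof.
move=> w0 e0 De; apply: le_trans (ler_wsqrtr De) _.
apply: le_trans (sqrt_subadd w0 e0) _; rewrite lerD2r.
exact/ler_wsqrtr/wt.
Qed.

Lemma ssqrt_le w D e : 0 <= w -> 0 <= e -> 0 <= D -> w <= D + e ->
  ssqrt w <= Num.sqrt D + Num.sqrt (e + d).
Proof.
move=> w0 e0 D0 De; have ed0 : 0 <= e + d by rewrite addr_ge0 // ltW.
apply: le_trans (sqrt_subadd D0 ed0); apply: ler_wsqrtr.
rewrite -/(t w); apply: (@le_trans _ _ (w + d)); last lra.
have wd : 0 <= w + d by rewrite addr_ge0 // ltW.
rewrite -(@ler_pXn2r _ 2) ?nnegrE ?(ltW (t0 w)) // t2 sqrrD.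
by have : 0 <= w * d by [rewrite mulr_ge0 // ltW]; lra.
Qed.

End SmoothSqrt.

Section SoftMin.
Variables (R : realType) (I : finType) (tau : R) (x : I -> R) (k0 : I).
Hypothesis tau0 : 0 < tau.

Definition expsum : R := \sum_k expR (- (x k / tau)).

Lemma expsum_gt0 : 0 < expsum.
Proof.
rewrite /expsum (bigD1 k0) //= ltr_wpDr ?expR_gt0 //.
by apply: sumr_ge0 => k _; exact: expR_ge0.
Qed.

Lemma softmin_le k : - tau * ln expsum <= x k.
Proof.
have h : - (x k / tau) <= ln expsum.
  rewrite -[leLHS]expRK ler_ln ?posrE ?expR_gt0 ?expsum_gt0 //.
  rewrite /expsum (bigD1 k) //= lerDl.
  by apply: sumr_ge0 => i _; exact: expR_ge0.
have := ler_wpM2l (ltW tau0) h.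
rewrite mulrN mulrCA divff ?gt_eqF // mulr1; lra.
Qed.

(** The sum has #|I| terms, each at most exp (- c / tau); the loss tau ln #|I| is bounded crudely by
    tau #|I|. *)
Lemma softmin_ge c : (forall k, c <= x k) -> c - tau * #|I|%:R <= - tau * ln expsum.
Proof.
move=> cx; have I0 : 0 < #|I|%:R :> R by rewrite ltr0n; apply/card_gt0P; exists k0.
have : expsum <= #|I|%:R * expR (- (c / tau)).
  rewrite mulr_natl -sumr_const.
  by apply: ler_sum => k _; rewrite ler_expR lerN2 ler_pM2r ?invr_gt0.
rewrite -ler_ln ?posrE ?expsum_gt0 ?mulr_gt0 ?expR_gt0 //.
rewrite lnM ?posrE ?expR_gt0 // expRK => h.
have := ler_wpM2l (ltW tau0) h.
rewrite mulrDr mulrN mulrCA divff ?gt_eqF // mulr1 => h'.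
have : tau * ln #|I|%:R <= tau * #|I|%:R.
  by rewrite ler_pM2l // ltW // ln_sublinear.
by lra.
Qed.

End SoftMin.

(** * The soft minimum of smooth distances as a function of class Z^1 *)

Section SmoothApproximation.
Variables (R : realType) (I : finType) (k0 : I) (Q : I -> profile R) (v : I -> R).
Variables (p d tau : R) (M : nat).
Hypotheses (p1 : 1 <= p) (M0 : (0 < M)%N) (d0 : 0 < d) (tau0 : 0 < tau).
Hypothesis eta1 : p ^+ 2 / M%:R <= 1.

(** The M smoothed tails, and as last moment the integral of g^2: together they determine every
    [sdist (Q k)]. *)
Let a (i : 'I_M.+1) (x : R) : R := if (i < M)%N then tailc p M i x else x ^+ 2.
Let a' (i : 'I_M.+1) (x : R) : R := if (i < M)%N then dtailc p M i x else 2 * x.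

Let da i (x : R) : is_derive x 1 (a i) (a' i x).
Proof.
rewrite /a /a'; case: ifP => _; first exact: is_derive_tailc.
apply: (@is_derive_quadratic _ _ _ _ 1) => h.
rewrite (_ : _ - _ = h ^+ 2); last ring.
by rewrite mul1r ger0_norm // sqr_ge0.
Qed.

Let ca' i : continuous (a' i : R -> R).
Proof.
have [iM|/negbTE iM] := boolP (i < M)%N.
  rewrite (_ : a' i = dtailc p M i); first exact: dtailc_continuous.
  by apply/funext => x; rewrite /a' iM.
rewrite (_ : a' i = fun x => 2 * x); last by apply/funext => x; rewrite /a' iM.
by move=> x; apply: cvgM; [exact: cvg_cst | exact: cvg_id].
Qed.

Let ma i : measurable_fun setT (fun g : G0m R => int01 (fun s => a i (G0fun g s))).
Proof.
apply: measurable_moment => [x|x _].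
  apply: differentiable_continuous; apply/derivable1_diffP.
  by have [] := da i x.
rewrite /a; case: ifP => _; last exact: sqr_ge0.
by have /andP[] := tailc_itv p M i x.
Qed.

Let mom := @moments R M.+1 a.

Let wid (i : 'I_M) : 'I_M.+1 := widen_ord (leqnSn M) i.

Let momE i g : mom g 0 (wid i) = tail p M g i.
Proof.
by rewrite mxE /tail; apply: eq_int01 => s _; rewrite /a /= ltn_ord.
Qed.

Let mom_max g : mom g 0 ord_max = int01 (fun s => g s ^+ 2).
Proof. by rewrite mxE; apply: eq_int01 => s _; rewrite /a /= ltnn. Qed.

Let const k : R := int01 (fun s => quant (Q k) s ^+ 2) + (7 + 8 * lip (Q k)) * (p ^+ 2 / M%:R).

Let W k (x : 'rV[R]_M.+1) : R :=
  x 0 ord_max + (- 2 / M%:R * \sum_(i < M) prim (Q k) (x 0 (wid i)) + const k).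

Let W_sdist k g : W k (mom g) = sdist (Q k) p M g.
Proof.
rewrite /W /sdist /const /cross mom_max (eq_bigr (fun i : 'I_M => prim (Q k) (tail p M g i)));
  last by move=> i _; rewrite momE.
ring.
Qed.

Let DW k (i : 'I_M.+1) (x : 'rV[R]_M.+1) : R :=
  (i == ord_max)%:R + (- 2 / M%:R *
    \sum_(j < M) slope (Q k) (x 0 (wid j)) * (i == wid j)%:R + 0).

Let cyl_W k : cyl a (W k) (DW k).
Proof.
apply: cyl_add; first exact: cyl_coord.
apply: cyl_add; last exact: cyl_cst.
apply: cyl_scale; apply: cyl_sum => j.
apply: cyl_comp; first exact: cyl_coord.
- apply: continuous_measurable_fun => x; apply: differentiable_continuous.
  by apply/derivable1_diffP; have [] := is_derive_prim (Q k) x.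
- by apply: continuous_measurable_fun; exact: slope_continuous.
- by move=> x; exact: is_derive_prim.
- by move=> x; exact: slope_continuous.
Qed.

Let cylgrad_W k g x : cylgrad a a' (DW k) g x = 2 * (x - dcross (Q k) p M g x).
Proof.
rewrite /DW cylgrad_add cylgrad_coord cylgrad_add.
rewrite (cylgrad_comp a a' (fun=> - 2 / M%:R)) cylgrad_sum.
rewrite [X in _ + (_ + X)]big1 ?addr0; last by move=> i _; rewrite mul0r.
rewrite {1}/a' /= ltnn mulrBr; congr (_ + _).
rewrite /dcross -mulrN -sumrN !mulr_sumr; apply: eq_bigr => j _.
rewrite (cylgrad_comp a a' (fun x => slope (Q k) (x 0 (wid j)))) cylgrad_coord.
rewrite -/(mom g) momE /a' /= ltn_ord /wt; ring.
Qed.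

Let phi k w : R := expR (- ((v k + ssqrt d w) / tau)).
Let phi' k w : R := - (dssqrt d w / tau) * phi k w.

Let phi_derive k (w : R) : is_derive w 1 (phi k) (phi' k w).
Proof.
have h := is_derive_ssqrt d0 w.
have h2 : is_derive w 1 (fun w => - ((v k + ssqrt d w) / tau) : R) (- (dssqrt d w / tau)).
  have h1 := is_deriveZ (- tau^-1) h.
  have := is_deriveD (is_derive_cst (- (v k / tau)) w 1) h1.
  rewrite add0r (_ : _ + _ = fun w => - ((v k + ssqrt d w) / tau)).
    by rewrite /GRing.scale /= mulNr mulrC.
  apply/funext => y; rewrite !fctE.
  change (- (v k / tau) + - tau^-1 * ssqrt d y = - ((v k + ssqrt d y) / tau)); ring.
have := @is_derive1_comp _ expR _ w _ _ (is_derive_expR _) h2.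
by rewrite /phi' mulrC.
Qed.

Let phi_continuous k : continuous (phi k).
Proof.
move=> w; apply: differentiable_continuous; apply/derivable1_diffP.
by have [] := phi_derive k w.
Qed.

Let phi'_continuous k : continuous (phi' k).
Proof.
move=> w; apply: cvgM; last exact: phi_continuous.
apply: cvgN; apply: cvgM; last exact: cvg_cst.
exact: dssqrt_continuous.
Qed.

Let V (x : 'rV[R]_M.+1) : R := \sum_k phi k (W k x).
Let DV i (x : 'rV[R]_M.+1) : R := \sum_k phi' k (W k x) * DW k i x.

Let VE x : V x = expsum tau (fun k => v k + ssqrt d (W k x)).
Proof. by []. Qed.

Let V_gt0 x : 0 < V x.
Proof. by rewrite VE; exact: expsum_gt0. Qed.

Let cyl_V : cyl a V DV.
Proof.
apply: cyl_sum => k; apply: cyl_comp (cyl_W k) _ _ _ _.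
- by apply: continuous_measurable_fun; exact: phi_continuous.
- by apply: continuous_measurable_fun; exact: phi'_continuous.
- by move=> x; exact: phi_derive.
- by move=> x; exact: phi'_continuous.
Qed.

Let U x : R := - tau * ln (V x).
(** The factor exp (- ln V) is 1 / V, as V > 0, in a form whose measurability and continuity follow
    from those of exp and ln. *)
Let DU i x : R := - tau * (expR (- ln (V x)) * DV i x).

Let cyl_U : cyl a U DU.
Proof.
apply: cyl_scale; apply: (cyl_comp cyl_V (phi := @ln R) (phi' := fun y => expR (- ln y))).
- exact: measurable_ln.
- apply: measurableT_comp; first exact: measurable_expR.
  by apply: measurableT_comp => //; exact: measurable_ln.
- by move=> x; rewrite expRN lnK ?posrE ?V_gt0 //; exact: is_derive1_ln.
- move=> x; apply: continuous_comp; last exact: continuous_expR.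
  by apply: cvgN; exact: continuous_ln.
Qed.

Lemma softmin_sdist : exists z : Z1data R,
  [/\ forall g, z_fun z g = - tau * ln (expsum tau
          (fun k => v k + ssqrt d (sdist (Q k) p M g))),
      forall g : G0 R,
        (\int[@lebesgue_measure R]_(t in `[0%R, 1%R]) ((z_grad z g t) ^+ 2)%:E <= 1)%E,
      measurable_fun setT (fun g : G0m R => z_fun z g) &
      measurable_fun setT (fun x : G0m R * R => z_grad z x.1 x.2)].
Proof.
have [z [zU zD mz mD]] := cyl_Z1data da ca' cyl_U.
exists z; split => // g.
  rewrite zU /U VE; congr (_ * ln _); apply: eq_bigr => k _.
  by rewrite -/mom W_sdist.
(* Gibbs weights: the gradient of the soft minimum is the convex combination, with weights [om k],
   of the gradients [b k] of the smoothed distances. *)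
pose om k := phi k (W k (mom g)) / V (mom g).
have om0 k : 0 <= om k by rewrite divr_ge0 ?expR_ge0 ?(ltW (V_gt0 _)).
have om1 : \sum_k om k = 1 by rewrite -mulr_suml -/(V _) divff // gt_eqF.
pose b k s := 2 * dssqrt d (W k (mom g)) * (g s - dcross (Q k) p M g (g s)).
have zE s : z_grad z g s = \sum_k om k * b k s.
  rewrite zD /DU (cylgrad_comp a a' (fun=> - tau)).
  rewrite (cylgrad_comp a a' (fun x => expR (- ln (V x)))) cylgrad_sum -/mom.
  rewrite expRN lnK ?posrE // !mulr_sumr; apply: eq_bigr => k _.
  rewrite (cylgrad_comp a a' (fun x => phi' k (W k x))) cylgrad_W -/mom.
  rewrite /om /b /phi'; have := V_gt0 (mom g) => ?; field.
  by rewrite !gt_eqF.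
have bg := G0_bmf g.
have bE k : bmf (fun s => g s - dcross (Q k) p M g (g s)).
  by apply: bmfB => //; exact: dcross_bmf.
have bb k : bmf (b k) by exact: bmfZ.
under eq_integral do rewrite zE.
have bs : bmf (fun s => \sum_k om k * b k s) by apply: bmf_sum => k; exact: bmfZ.
rewrite (int01_EFin (bmf_sqr bs)) lee_fin.
have bs2 : bmf (fun s => \sum_k om k * b k s ^+ 2).
  by apply: bmf_sum => k; apply: bmfZ; exact: bmf_sqr.
apply: (@le_trans _ _ (int01 (fun s => \sum_k om k * b k s ^+ 2))).
  apply: le_int01 => //; first exact: bmf_sqr.
  move=> s _; rewrite -[leRHS]mul1r; apply: sqr_sum_weights => //.
  by rewrite om1.
rewrite int01_sum; last by move=> k; apply: bmfZ; exact: bmf_sqr.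
rewrite -om1; apply: ler_sum => k _; rewrite int01Z; last exact: bmf_sqr.
rewrite ler_piMr //.
rewrite (_ : (fun s => b k s ^+ 2) = fun s => (2 * dssqrt d (W k (mom g))) ^+ 2 *
    (g s - dcross (Q k) p M g (g s)) ^+ 2); last by apply/funext => s; rewrite exprMn.
rewrite int01Z; last exact: bmf_sqr.
apply: dssqrt_le1 => //; rewrite W_sdist grad_le_sdist // andbT.
by apply: int01_ge0 => s _; exact: sqr_ge0.
Qed.

End SmoothApproximation.

(** * Uniform approximation of a 1-Lipschitz function *)

Section SmoothApprox.
Variables (R : realType) (u : G0m R -> R).
Hypothesis u_lip : forall g h : G0m R, `|u g - u h| <= L2dist (G0fun g) (G0fun h).

Definition good (e : R) (z : Z1data R) : Prop :=
  [/\ forall g, `|z_fun z g - u g| <= e,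
      forall g : G0 R,
        (\int[@lebesgue_measure R]_(t in `[0%R, 1%R]) ((z_grad z g t) ^+ 2)%:E <= 1)%E,
      measurable_fun setT (fun g : G0m R => z_fun z g) &
      measurable_fun setT (fun x : G0m R * R => z_grad z x.1 x.2)].

(** The soft minimum of u (h k) plus the smoothed distance to h k. From below the errors are c for
    the distance and c for the soft minimum; from above, a net point within c contributes c through
    u and 3 c through its smoothed distance. *)
Lemma good_exists (e : R) : 0 < e -> exists z, good e z.
Proof.
move=> e0; pose c := e / 8; have c0 : 0 < c by rewrite divr_gt0.
have c2 : 0 < c ^+ 2 by rewrite exprn_gt0.
have [I [Q net]] := profile_net c2.
have [k0 _] := net point.
pose n : R := #|I|%:R.
have n0 : 0 < n by rewrite ltr0n; apply/card_gt0P; exists k0.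
pose L := \sum_k lip (Q k).
have lipL k : lip (Q k) <= L.
  by rewrite /L (bigD1 k) //= lerDl; apply: sumr_ge0 => i _; exact: lip_ge0.
have L0 : 0 <= L := le_trans (lip_ge0 (Q k0)) (lipL k0).
(* p controls the smoothing error 4 / p; then M, chosen after p, controls B / M, where B collects
   the coefficients of 1 / M. Each gets half of c^2. *)
pose p := 1 + 12 / c ^+ 2.
have pc : 12 / c ^+ 2 <= p by rewrite lerDr.
have p1 : 1 <= p by rewrite lerDl divr_ge0 // ltW.
have p0 : 0 < p by exact: lt_le_trans p1.
pose B := (7 + 8 * L) * p ^+ 2 + 2.
pose M := (Num.truncn (p ^+ 2 + B * 2 / c ^+ 2)).+1.
have pp : 0 <= p ^+ 2 := sqr_ge0 p.
have B0 : 0 <= B by rewrite addr_ge0 // mulr_ge0 //; lra.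
have Bc : 0 <= B * 2 / c ^+ 2 by rewrite divr_ge0 ?mulr_ge0 // ltW.
have MX : p ^+ 2 + B * 2 / c ^+ 2 <= M%:R by rewrite ltW // truncnS_gt.
have M0' : (0 < M)%N by [].
have M0 : 0 < M%:R :> R by rewrite ltr0n.
have eta1 : p ^+ 2 / M%:R <= 1 by rewrite ler_pdivrMr // mul1r; lra.
have BM : B / M%:R <= c ^+ 2 / 2.
  rewrite ler_pdivrMr // mulrAC ler_pdivlMr //.
  by rewrite -ler_pdivrMl // mulrC; lra.
have pM : 4 / p <= c ^+ 2 / 2.
  rewrite ler_pdivrMr // mulrAC ler_pdivlMr //.
  by move: pc; rewrite ler_pdivrMr // => ?; rewrite mulrC; lra.
have tau0 : 0 < c / n by rewrite divr_gt0.
pose h k := quant_G0 (Q k).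
pose v k := u (h k).
have [z [zE zg mz mg]] := @softmin_sdist R I k0 Q v p (c ^+ 2) (c / n) M p1 M0' c2 tau0 eta1.
exists z; split => // g; rewrite zE.
pose D k := int01 (fun s => (g s - h k s) ^+ 2).
have D0 k : 0 <= D k by apply: int01_ge0 => s _; exact: sqr_ge0.
have DW k : `|sdist (Q k) p M g - D k| <= c ^+ 2.
  rewrite /D int01_quant_G0.
  have /le_trans := sdist_approx (Q k) g p1 M0'; apply.
  apply: (@le_trans _ _ (B / M%:R + 4 / p)); last lra.
  rewrite (_ : B / M%:R = (7 + 8 * L) * (p ^+ 2 / M%:R) + 2 / M%:R); last first.
    by rewrite /B; ring.
  have : (7 + 8 * lip (Q k)) * (p ^+ 2 / M%:R) <= (7 + 8 * L) * (p ^+ 2 / M%:R).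
    by rewrite ler_wpM2r ?divr_ge0 ?(ltW M0) //; have := lipL k; lra.
  by rewrite mulrDr -!(mulrCA 2) (_ : 2 * (2 / p) = 4 / p); [lra|ring].
have W0 k : 0 <= sdist (Q k) p M g.
  apply: le_trans (grad_le_sdist (Q k) g p1 M0' eta1).
  by apply: int01_ge0 => s _; exact: sqr_ge0.
have cE : Num.sqrt (c ^+ 2) = c by rewrite sqrtr_sqr gtr0_norm.
have lo k : Num.sqrt (D k) <= ssqrt (c ^+ 2) (sdist (Q k) p M g) + c.
  rewrite -cE; rewrite {1}cE; apply: ssqrt_ge => //; [exact: ltW|].
  by have := DW k; rewrite ler_norml => /andP[? ?]; lra.
have hi k : ssqrt (c ^+ 2) (sdist (Q k) p M g) <= Num.sqrt (D k) + 2 * c.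
  apply: le_trans (@ssqrt_le _ _ c2 _ (D k) (c ^+ 2) (W0 k) (ltW c2) (D0 k) _) _.
    by have := DW k; rewrite ler_norml => /andP[? ?]; lra.
  rewrite lerD2l; have := sqrt_subadd (ltW c2) (ltW c2); rewrite cE; lra.
have uD k : `|u g - v k| <= Num.sqrt (D k) := u_lip g (h k).
rewrite ler_distl; apply/andP; split.
  have := @softmin_ge R I (c / n) (fun k => v k + ssqrt (c ^+ 2) (sdist (Q k) p M g)) k0 tau0
    (u g - c) => H.
  have := H; rewrite -/n divfK ?gt_eqF // => {}H.
  have : u g - c - c <= - (c / n) * ln (expsum (c / n)
      (fun k => v k + ssqrt (c ^+ 2) (sdist (Q k) p M g))).
    apply: H => k; have := uD k; rewrite ler_norml => /andP[_ ?].
    by have := lo k; lra.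
  by rewrite /c; lra.
have [k kg] := net g.
have Dk : Num.sqrt (D k) <= c by rewrite -cE ler_wsqrtr // /D int01_quant_G0.
have := @softmin_le R I (c / n) (fun k => v k + ssqrt (c ^+ 2) (sdist (Q k) p M g)) k0 tau0 k.
have := hi k; have := uD k; rewrite ler_norml => /andP[? _] ? ?.
by apply: (@le_trans _ _ (u g + 4 * c)); [lra | rewrite /c; lra].
Qed.

End SmoothApprox.

(** * Midpoints and minimising sequences *)

Section Midpoint.
Variable R : realType.

(** The two families of moments are concatenated, and each outer function reads its own half of the
    vector. *)
Lemma midpoint_Z1data (z1 z2 : Z1data R) : exists z : Z1data R,
  (forall g, z_fun z g = (z_fun z1 g + z_fun z2 g) / 2) /\
  (forall g t, z_grad z g t = (z_grad z1 g t + z_grad z2 g t) / 2).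
Proof.
case: z1 z2 => [m1 U1 a1 U1C a1C] [m2 U2 a2 U2C a2C].
pose U (x : 'rV[R]_(m1 + m2)) : R := (U1 (lsubmx x) + U2 (rsubmx x)) / 2.
pose a (i : 'I_(m1 + m2)) : R -> R :=
  match fintype.split i with inl j => a1 j | inr j => a2 j end.
have al j : a (lshift m2 j) = a1 j by rewrite /a (unsplitK (inl j)).
have ar j : a (rshift m1 j) = a2 j by rewrite /a (unsplitK (inr j)).
have cl : continuous (lsubmx : 'rV[R]_(m1 + m2) -> 'rV[R]_m1).
  by move=> x; apply: differentiable_continuous; exact: differentiable_lsubmx.
have cr : continuous (rsubmx : 'rV[R]_(m1 + m2) -> 'rV[R]_m2).
  by move=> x; apply: differentiable_continuous; exact: differentiable_rsubmx.
have Ul x j : (fun s : R => U (x + s *: delta_mx 0 (lshift m2 j))) =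
    fun s => (U1 (lsubmx x + s *: delta_mx 0 j) + U2 (rsubmx x)) / 2.
  apply/funext => s; rewrite /U; congr ((U1 _ + U2 _) / 2); apply/rowP => i; rewrite !mxE.
    by rewrite eq_lshift.
  by rewrite eq_rlshift andbF mulr0 addr0.
have Ur x j : (fun s : R => U (x + s *: delta_mx 0 (rshift m1 j))) =
    fun s => (U1 (lsubmx x) + U2 (rsubmx x + s *: delta_mx 0 j)) / 2.
  apply/funext => s; rewrite /U; congr ((U1 _ + U2 _) / 2); apply/rowP => i; rewrite !mxE.
    by rewrite eq_lrshift andbF mulr0 addr0.
  by rewrite eq_rshift.
have half (f f' : R -> R) c df : f' = (fun s => c + f s / 2) -> is_derive (0 : R) 1 f df ->
    is_derive (0 : R) 1 f' (df / 2).
  move=> -> hf; have := is_deriveD (is_derive_cst c (0 : R) 1) (is_deriveZ 2^-1 hf).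
  rewrite add0r (_ : _ *: _ = df / 2); last by rewrite mulrC.
  by rewrite (_ : _ + _ = fun s => c + f s / 2) //; apply/funext => s; rewrite !fctE mulrC.
have D1 j x : is_derive (0 : R) 1 (fun s : R => U1 (x + s *: delta_mx 0 j)) (partial U1 j x).
  by have [d _] := U1C j; apply: DeriveDef; [exact: d | rewrite /partial derive1E].
have D2 j x : is_derive (0 : R) 1 (fun s : R => U2 (x + s *: delta_mx 0 j)) (partial U2 j x).
  by have [d _] := U2C j; apply: DeriveDef; [exact: d | rewrite /partial derive1E].
have dl j x : is_derive (0 : R) 1 (fun s : R => U (x + s *: delta_mx 0 (lshift m2 j)))
    (partial U1 j (lsubmx x) / 2).
  apply: (half _ _ (U2 (rsubmx x) / 2) _ _ (D1 j (lsubmx x))).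
  by rewrite Ul; apply/funext => s; ring.
have dr j x : is_derive (0 : R) 1 (fun s : R => U (x + s *: delta_mx 0 (rshift m1 j)))
    (partial U2 j (rsubmx x) / 2).
  apply: (half _ _ (U1 (lsubmx x) / 2) _ _ (D2 j (rsubmx x))).
  by rewrite Ur; apply/funext => s; ring.
have pl j : partial U (lshift m2 j) = fun x => partial U1 j (lsubmx x) / 2.
  by apply/funext => x; rewrite {1}/partial derive1E; have [_ ->] := dl j x.
have pr j : partial U (rshift m1 j) = fun x => partial U2 j (rsubmx x) / 2.
  by apply/funext => x; rewrite {1}/partial derive1E; have [_ ->] := dr j x.
have UC : C1_Rm U.
  move=> i; rewrite -(splitK i); case: (fintype.split i) => j /=; split.
  - by move=> x; have [] := dl j x.
  - rewrite pl => x; have [_ c1] := U1C j.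
    exact: (cvgM (@continuous_comp _ _ _ lsubmx (partial U1 j) x (cl x) (c1 _)) (cvg_cst _)).
  - by move=> x; have [] := dr j x.
  - rewrite pr => x; have [_ c2] := U2C j.
    exact: (cvgM (@continuous_comp _ _ _ rsubmx (partial U2 j) x (cr x) (c2 _)) (cvg_cst _)).
have aC i : C1_R (a i) by rewrite /a; case: (fintype.split i) => j.
exists (MkZ1 UC aC).
have ml g : lsubmx (z_moments (MkZ1 UC aC) g) = z_moments (MkZ1 U1C a1C) g.
  by apply/rowP => j; rewrite !mxE /= al.
have mr g : rsubmx (z_moments (MkZ1 UC aC) g) = z_moments (MkZ1 U2C a2C) g.
  by apply/rowP => j; rewrite !mxE /= ar.
split => [g|g t]; first by rewrite /z_fun /= /U ml mr.
rewrite /z_grad /= big_split_ord /= mulrDl !mulr_suml.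
congr (_ + _); apply: eq_bigr => j _.
  by rewrite pl al ml mulrAC.
by rewrite pr ar mr mulrAC.
Qed.

(** Convexity of the constraints: the gradient bound uses ((x + y) / 2)^2 <= x^2 / 2 + y^2 / 2
    pointwise. *)
Lemma good_midpoint (u : G0m R -> R) (e1 e2 e : R) z1 z2 : e1 <= e -> e2 <= e ->
  good u e1 z1 -> good u e2 z2 ->
  exists2 z, good u e z & forall g t, z_grad z g t = (z_grad z1 g t + z_grad z2 g t) / 2.
Proof.
move=> e1e e2e [u1 n1 m1 d1] [u2 n2 m2 d2].
have [z [zE gE]] := midpoint_Z1data z1 z2; exists z => //; split.
- move=> g; rewrite zE; have := u1 g; have := u2 g.
  by rewrite !ler_norml => /andP[? ?] /andP[? ?]; apply/andP; split; lra.
- move=> g; under eq_integral do rewrite gE.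
  have m1' : measurable_fun (`[0%R, 1%R]%classic : set R) (fun t : R => ((z_grad z1 g t ^+ 2) / 2)%:E).
    apply/measurable_EFinP; apply: measurable_funM => //; apply: measurable_funX.
    by apply: measurable_funTS; exact: (measurableT_comp d1 (pair1_measurable (g : G0m R))).
  have m2' : measurable_fun (`[0%R, 1%R]%classic : set R) (fun t : R => ((z_grad z2 g t ^+ 2) / 2)%:E).
    apply/measurable_EFinP; apply: measurable_funM => //; apply: measurable_funX.
    by apply: measurable_funTS; exact: (measurableT_comp d2 (pair1_measurable (g : G0m R))).
  have n1' : (\int[@lebesgue_measure R]_(t in `[0%R, 1%R]) ((z_grad z1 g t ^+ 2) / 2)%:E
      <= 2^-1%:E)%E.
    under eq_integral do rewrite mulrC EFinM.
    rewrite ge0_integralZl_EFin //.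
    + by rewrite -[leRHS]mule1 lee_pmul2l ?lte_fin //; exact: n1.
    + by move=> x _; rewrite lee_fin sqr_ge0.
    + apply/measurable_EFinP; apply: measurable_funX; apply: measurable_funTS.
      exact: (measurableT_comp d1 (pair1_measurable (g : G0m R))).
  have n2' : (\int[@lebesgue_measure R]_(t in `[0%R, 1%R]) ((z_grad z2 g t ^+ 2) / 2)%:E
      <= 2^-1%:E)%E.
    under eq_integral do rewrite mulrC EFinM.
    rewrite ge0_integralZl_EFin //.
    + by rewrite -[leRHS]mule1 lee_pmul2l ?lte_fin //; exact: n2.
    + by move=> x _; rewrite lee_fin sqr_ge0.
    + apply/measurable_EFinP; apply: measurable_funX; apply: measurable_funTS.
      exact: (measurableT_comp d2 (pair1_measurable (g : G0m R))).
  apply: (@le_trans _ _ (2^-1%:E + 2^-1%:E)%E); last first.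
    by rewrite -EFinD lee_fin; lra.
  apply: le_trans (leeD n1' n2'); rewrite -ge0_integralD //; last 2 first.
  + by move=> t _; rewrite lee_fin divr_ge0 // sqr_ge0.
  + by move=> t _; rewrite lee_fin divr_ge0 // sqr_ge0.
  apply: ge0_le_integral => //.
  + by move=> t _; rewrite lee_fin sqr_ge0.
  + apply/measurable_EFinP; apply: measurable_funX; apply: measurable_funM => //.
    by apply: measurable_funD; apply: measurable_funTS;
      [exact: (measurableT_comp d1 (pair1_measurable (g : G0m R)))|exact: (measurableT_comp d2 (pair1_measurable (g : G0m R)))].
  + exact: emeasurable_funD.
  + move=> t _; rewrite -EFinD lee_fin.
    have := sqr_ge0 (z_grad z1 g t - z_grad z2 g t); nra.
- rewrite (_ : (fun g => _) = fun g => (z_fun z1 g + z_fun z2 g) / 2); last exact/funext.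
  by apply: measurable_funM => //; exact: measurable_funD.
- rewrite (_ : (fun x => _) = fun x : G0m R * R => (z_grad z1 x.1 x.2 + z_grad z2 x.1 x.2) / 2).
    by apply: measurable_funM => //; exact: measurable_funD.
  by apply/funext => x; rewrite gE.
Qed.

End Midpoint.

(** * Integrals over G_0 x [0,1] and L^2 completeness *)

Section L2.
Variables (R : realType) (Q : probability (G0m R) R).
Local Notation T := (G0m R * R)%type.

Definition iint01 (f : T -> \bar R) : \bar R :=
  (\int[Q]_g \int[@lebesgue_measure R]_(t in `[0%R, 1%R]) f (g, t))%E.

Let slice (f : T -> \bar R) (g : G0m R) : measurable_fun setT f ->
  measurable_fun (`[0%R, 1%R]%classic : set R) (fun t => f (g, t)).
Proof. by move=> mf; apply: measurable_funTS; exact: (measurableT_comp mf (pair1_measurable g)). Qed.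

Let inner_ge0 (f : T -> \bar R) g : (forall x, 0 <= f x)%E ->
  (0 <= \int[@lebesgue_measure R]_(t in `[0%R, 1%R]) f (g, t))%E.
Proof. by move=> f0; apply: integral_ge0. Qed.

Lemma iint01_ge0 f : (forall x, 0 <= f x)%E -> (0 <= iint01 f)%E.
Proof. by move=> f0; apply: integral_ge0 => g _; exact: inner_ge0. Qed.

Lemma le_iint01 f h : measurable_fun setT f -> measurable_fun setT h ->
  (forall x, 0 <= f x)%E -> (forall x, f x <= h x)%E -> (iint01 f <= iint01 h)%E.
Proof.
move=> mf mh f0 fh; have h0 x : (0 <= h x)%E := le_trans (f0 x) (fh x).
apply: ge0_le_integral => //.
- by move=> g _; exact: inner_ge0.
- exact: measurable_integral01.
- exact: measurable_integral01.
by move=> g _; apply: ge0_le_integral => //; exact: slice.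
Qed.

Lemma iint01D f h : measurable_fun setT f -> measurable_fun setT h ->
  (forall x, 0 <= f x)%E -> (forall x, 0 <= h x)%E ->
  iint01 (fun x => f x + h x)%E = (iint01 f + iint01 h)%E.
Proof.
move=> mf mh f0 h0; rewrite /iint01 -ge0_integralD //.
- apply: eq_integral => g _; rewrite ge0_integralD //; exact: slice.
- by move=> g _; exact: inner_ge0.
- exact: measurable_integral01.
- by move=> g _; exact: inner_ge0.
- exact: measurable_integral01.
Qed.

Lemma iint01Z (c : R) f : measurable_fun setT f -> (forall x, 0 <= f x)%E -> 0 <= c ->
  iint01 (fun x => c%:E * f x)%E = (c%:E * iint01 f)%E.
Proof.
move=> mf f0 c0; rewrite /iint01 -ge0_integralZl_EFin //.
- apply: eq_integral => g _; rewrite ge0_integralZl_EFin //; exact: slice.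
- by move=> g _; exact: inner_ge0.
- exact: measurable_integral01.
Qed.

Lemma iint01_nneseries (f : nat -> T -> \bar R) : (forall n, measurable_fun setT (f n)) ->
  (forall n x, 0 <= f n x)%E ->
  (iint01 (fun x => \sum_(0 <= n <oo) f n x) = \sum_(0 <= n <oo) iint01 (f n))%E.
Proof.
move=> mf f0; rewrite /iint01 -integral_nneseries //.
- apply: eq_integral => g _; rewrite integral_nneseries //.
  by move=> n; exact: slice.
- by move=> n; exact: measurable_integral01.
- by move=> n g _; exact: inner_ge0.
Qed.

Lemma measurable_sqr (f : T -> R) : measurable_fun setT f ->
  measurable_fun setT (fun x => ((f x) ^+ 2)%:E).
Proof. by move=> mf; apply/measurable_EFinP; exact: measurable_funX. Qed.

Let sqr0 (f : T -> R) x : (0 <= ((f x) ^+ 2)%:E)%E.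
Proof. by rewrite lee_fin sqr_ge0. Qed.

(** Written with the midpoint, which is the gradient of another competitor, and without subtraction,
    so that infinite values are allowed. *)
Lemma parallelogram (f h : T -> R) : measurable_fun setT f -> measurable_fun setT h ->
  (iint01 (fun x => ((f x - h x) ^+ 2)%:E) +
    4%:E * iint01 (fun x => (((f x + h x) / 2) ^+ 2)%:E) =
  2%:E * iint01 (fun x => (f x ^+ 2)%:E) + 2%:E * iint01 (fun x => (h x ^+ 2)%:E))%E.
Proof.
move=> mf mh.
have m1 := measurable_sqr mf; have m2 := measurable_sqr mh.
have m3 := measurable_sqr (measurable_funB mf mh).
have m4 : measurable_fun setT (fun x => (((f x + h x) / 2) ^+ 2)%:E).
  by apply: measurable_sqr; apply: measurable_funM => //; exact: measurable_funD.
have Z (c : R) (k : T -> \bar R) : measurable_fun setT k -> (forall x, 0 <= k x)%E -> 0 <= c ->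
    measurable_fun setT (fun x => c%:E * k x)%E /\ forall x, (0 <= c%:E * k x)%E.
  by move=> mk k0 c0; split; [apply: emeasurable_funM => //|move=> x; exact: mule_ge0].
have [Z1 Z1'] := Z 2 _ m1 (@sqr0 _) (ler0n _ 2).
have [Z2 Z2'] := Z 2 _ m2 (@sqr0 _) (ler0n _ 2).
have [Z4 Z4'] := Z 4 _ m4 (@sqr0 _) (ler0n _ 4).
rewrite -(iint01Z m4 (@sqr0 _) (ler0n _ 4)).
rewrite -(iint01Z m1 (@sqr0 _) (ler0n _ 2)) -(iint01Z m2 (@sqr0 _) (ler0n _ 2)).
rewrite -(iint01D m3 Z4 (@sqr0 _) Z4') -(iint01D Z1 Z2 Z1' Z2').
congr iint01; apply/funext => x.
rewrite -!EFinM -!EFinD -[(f \- h) x]/(f x - h x); congr EFin; by field.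
Qed.

Section Complete.
Variable f : nat -> T -> R.
Hypothesis mf : forall n, measurable_fun setT (f n).
Hypothesis fC : forall n,
  (iint01 (fun x => ((f n.+1 x - f n x) ^+ 2)%:E) <= ((4^-1) ^+ n)%:E)%E.

(** The weight 2^n is small enough for S to have integral at most the sum of 2^n 4^-n = 2, and large
    enough for finiteness of S x to force convergence of f n x. *)
Let term n x : \bar R := (2%:R ^+ n * (f n.+1 x - f n x) ^+ 2)%:E.
Let S x : \bar R := (\sum_(0 <= n <oo) term n x)%E.

Let term0 n x : (0 <= term n x)%E.
Proof. by rewrite lee_fin mulr_ge0 // sqr_ge0. Qed.

Let mterm n : measurable_fun setT (term n).
Proof.
apply/measurable_EFinP; apply: measurable_funM => //.
by apply: measurable_funX; exact: measurable_funB.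
Qed.

Let mS : measurable_fun setT S.
Proof. by apply: ge0_emeasurable_sum. Qed.

Let S0 x : (0 <= S x)%E.
Proof. by apply: nneseries_ge0. Qed.

Let geo_le n : (\sum_(i < n) (2^-1) ^+ i <= 2 :> R).
Proof.
suff -> : \sum_(i < n) (2^-1) ^+ i = 2 - 2 * (2^-1) ^+ n :> R.
  by rewrite gerBl mulr_ge0 // exprn_ge0.
elim: n => [|n IH]; first by rewrite big_ord0 expr0; ring.
by rewrite big_ord_recr /= IH exprS; field.
Qed.

Let intS : (iint01 S <= 2%:E)%E.
Proof.
rewrite iint01_nneseries //.
apply: lime_le; first by apply: is_cvg_nneseries => n _ _; exact: iint01_ge0.
near=> n; rewrite big_mkord.
apply: (@le_trans _ _ (\sum_(i < n) ((2^-1) ^+ i)%:E)%E); last by rewrite sumEFin lee_fin.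
apply: lee_sum => i _; rewrite /term.
under [X in iint01 X]funext do rewrite EFinM.
rewrite iint01Z; last 3 first.
  exact: (measurable_sqr (measurable_funB (mf i.+1) (mf i))).
  by move=> y; exact: sqr_ge0.
  exact: exprn_ge0.
apply: (@le_trans _ _ ((2 ^+ i)%:E * (4^-1 ^+ i)%:E)%E); first by rewrite lee_pmul2l ?lte_fin ?exprn_gt0.
rewrite -EFinM lee_fin -exprMn (_ : 2 * 4^-1 = 2^-1 :> R) //; by field.
Unshelve. all: by end_near.
Qed.

Let half_pow_sqr k (y : R) : (2^-1) ^+ k * (2 ^+ k * y) ^+ 2 = 2 ^+ k * y ^+ 2.
Proof.
rewrite exprMn mulrA (expr2 (2 ^+ k)) (mulrA ((2^-1) ^+ k)) -exprMn mulVf //.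
by rewrite expr1n mul1r.
Qed.

Let sum_shift x n m :
  (\sum_(n <= i < n + m) term i x = \sum_(i < m) term (n + i)%N x)%E.
Proof.
rewrite -{1}[n]add0n big_addn addKn big_mkord.
by apply: eq_bigr => i _; rewrite addnC.
Qed.

(** Each increment is written as 2^-i times its 2^i multiple; Jensen with the weights 2^-i, of mass
    at most 2 * 2^-n, produces the terms of S. *)
Let tail_bound x n m : (S x < +oo)%E -> (f (n + m)%N x - f n x) ^+ 2 <=
  2 * (2^-1) ^+ n * fine (S x).
Proof.
move=> Sx; have SE : (fine (S x))%:E = S x by rewrite fineK // ge0_fin_numE.
have tele : f (n + m)%N x - f n x =
    \sum_(i < m) (2^-1) ^+ (n + i) * (2 ^+ (n + i) * (f (n + i).+1 x - f (n + i)%N x)).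
  elim: m => [|m IH]; first by rewrite addn0 big_ord0 subrr.
  rewrite big_ord_recr /= -IH addnS mulrA -exprMn mulVf // expr1n mul1r; ring.
rewrite tele.
have w0 : 0 < 2 * (2^-1) ^+ n :> R by rewrite mulr_gt0 // exprn_gt0.
have W0 (i : 'I_m) : 0 <= (2^-1) ^+ (n + i) :> R by rewrite exprn_ge0.
have W1 : \sum_(i < m) (2^-1) ^+ (n + i) <= 2 * (2^-1) ^+ n :> R.
  by under eq_bigr do rewrite exprD; rewrite -mulr_sumr mulrC ler_pM2r ?exprn_gt0.
have := sqr_sum_weights (fun i : 'I_m => 2 ^+ (n + i) * (f (n + i).+1 x - f (n + i)%N x))
  w0 W0 W1.
move=> /le_trans; apply.
rewrite ler_pM2l //.
rewrite -lee_fin SE -sumEFin.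
apply: le_trans (_ : \sum_(n <= i < n + m) term i x <= _)%E.
  rewrite sum_shift; apply: lee_sum => i _.
  by rewrite lee_fin half_pow_sqr.
have le1 : (\sum_(n <= i < n + m) term i x <= \sum_(0 <= i < n + m) term i x)%E.
  rewrite (@big_cat_nat _ _ _ n 0%N (n + m)%N) ?leq_addr //= leeDr //.
  by apply: sume_ge0 => i _; exact: term0.
apply: (le_trans le1); apply: nneseries_lim_ge => i _ _; exact: term0.
Qed.

Let geo_cvg (c : R) : 2 * (2^-1) ^+ n * c @[n --> \oo] --> (0 : R).
Proof.
have h : `|2^-1| < 1 :> R by rewrite ger0_norm // invf_lt1 // ltr1n.
have := cvgMr_tmp (b := c) (cvgMl_tmp (a := 2) (cvg_expr h)).
by rewrite mulr0 mul0r => H; exact: H.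
Qed.

Let f_cvg x : (S x < +oo)%E -> cvgn (f ^~ x).
Proof.
move=> Sx; apply/cauchy_cvgP/cauchy_exP => e e0.
have e2 : 0 < e ^+ 2 by rewrite exprn_gt0.
have [n _ nP] : \forall n \near \oo, 2 * (2^-1) ^+ n * fine (S x) < e ^+ 2.
  have := @geo_cvg (fine (S x)) => /cvgrPdist_lt /(_ _ e2).
  apply: filterS => n; rewrite sub0r normrN; apply: le_lt_trans; exact: ler_norm.
exists (f n x); exists n => // m /= nm.
rewrite /ball /= -[m](subnKC nm) distrC.
rewrite -(@ltr_pXn2r _ 2) ?nnegrE ?normr_ge0 ?(ltW e0) //. rewrite real_normK ?num_real //.
exact: le_lt_trans (tail_bound _ _ Sx) (nP _ (leqnn n)).
Qed.

Let A : set T := [set x | (S x < +oo)%E].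

Let mA : measurable A.
Proof. by rewrite -[A]setTI; exact: emeasurable_fun_infty_o. Qed.

Let indA x : \1_A x = ((S x < +oo)%E)%:R :> R.
Proof.
rewrite indicE; case: (boolP (S x < +oo)%E) => h; first by rewrite mem_set.
by rewrite memNset //; exact/negP.
Qed.

(** The pointwise limit where S is finite, and 0 elsewhere. *)
Let F x : R := \1_A x * limn (f ^~ x).

Let hF x : (\1_A x * f n x) @[n --> \oo] --> F x.
Proof.
rewrite /F indA; case: (boolP (S x < +oo)%E) => Sx; last first.
  by rewrite mul0r; under eq_fun do rewrite mul0r; exact: cvg_cst.
by apply: cvgMl_tmp; exact: f_cvg.
Qed.

Let mh n : measurable_fun setT (fun x => \1_A x * f n x).
Proof. by apply: measurable_funM => //; exact: measurable_indic. Qed.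

Let mF : measurable_fun setT F.
Proof.
apply: (@measurable_fun_cvg _ _ _ _ (fun n x => \1_A x * f n x)) => //.
Qed.

(** Where S is infinite the right side is too, so the bound holds everywhere and can be integrated
    directly. *)
Let F_bound n x : (((f n x - F x) ^+ 2)%:E <= (2 * (2^-1) ^+ n)%:E * S x)%E.
Proof.
have c0 : 0 < 2 * (2^-1) ^+ n :> R by rewrite mulr_gt0 // exprn_gt0.
have [Sx|] := boolP (S x < +oo)%E; last first.
  by rewrite -leNgt leye_eq => /eqP ->; rewrite gt0_muley ?lte_fin // leey.
have SE : S x = (fine (S x))%:E by rewrite fineK // ge0_fin_numE.
rewrite SE -EFinM lee_fin.
have cF : f m x @[m --> \oo] --> F x.
  by rewrite /F indA Sx mul1r; exact: f_cvg.
have c2 : (f n x - f m x) ^+ 2 @[m --> \oo] --> (f n x - F x) ^+ 2.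
  have c1 : f n x - f m x @[m --> \oo] --> f n x - F x by apply: cvgB => //; exact: cvg_cst.
  by rewrite expr2; under eq_fun do rewrite expr2; apply: cvgM; exact: c1.
rewrite -(cvg_lim _ c2) //; apply: limr_le; first by apply/cvg_ex; eexists; exact: c2.
near=> m; have nm : (n <= m)%N by near: m; exists n.
by rewrite -sqrrN opprB -[m](subnKC nm); exact: tail_bound.
Unshelve. all: by end_near.
Qed.

(** The last clause concerns each single g: [\1_A * f n] converges to F at every point and is
    dominated by f n in absolute value, so Fatou's lemma on [0,1] applies without an exceptional set
    of g. *)
Lemma L2_complete : exists F : T -> R,
  [/\ measurable_fun setT F,
      iint01 (fun x => ((f n x - F x) ^+ 2)%:E) @[n --> \oo] --> 0%E &
      forall g, (forall n, \int[@lebesgue_measure R]_(t in `[0%R, 1%R])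
          ((f n (g, t)) ^+ 2)%:E <= 1)%E ->
        (\int[@lebesgue_measure R]_(t in `[0%R, 1%R]) ((F (g, t)) ^+ 2)%:E <= 1)%E].
Proof.
exists F; split => //.
  have : (2 * (2^-1) ^+ n * 2)%:E @[n --> \oo] --> (0 : R)%:E.
    by apply: cvg_EFin; [near=> n | exact: geo_cvg].
  apply: squeeze_cvge; last exact: cvg_cst. 
  near=> n; apply/andP; split; first by apply: iint01_ge0 => x; rewrite lee_fin sqr_ge0.
  have c0 : 0 <= 2 * (2^-1) ^+ n :> R by rewrite mulr_ge0 // exprn_ge0.
  apply: (@le_trans _ _ ((2 * (2^-1) ^+ n)%:E * iint01 S)%E); last first.
    by rewrite [leRHS]EFinM; apply: lee_wpmul2l; [rewrite lee_fin|exact: intS].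
  rewrite -(iint01Z mS S0 c0); apply: le_iint01.
  - exact: (measurable_sqr (measurable_funB (mf n) mF)).
  - by apply: emeasurable_funM => //; exact: measurable_cst.
  - by move=> x; rewrite lee_fin sqr_ge0.
  - exact: F_bound.
move=> g fg.
have cF2 t : ((\1_A (g, t) * f n (g, t)) ^+ 2)%:E @[n --> \oo] --> ((F (g, t)) ^+ 2)%:E.
  apply: cvg_EFin; first by near=> n.
  rewrite expr2; under eq_fun do rewrite expr2.
  apply: cvgM; exact: hF.
have FE t : ((F (g, t)) ^+ 2)%:E = limn_einf (fun n => ((\1_A (g, t) * f n (g, t)) ^+ 2)%:E).
  by have [-> _] := cvg_limn_einf_sup (cF2 t).
under eq_integral do rewrite FE.
have m2 n : measurable_fun (`[0%R, 1%R]%classic : set R)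
    (fun t => ((\1_A (g, t) * f n (g, t)) ^+ 2)%:E).
  exact: (slice g (measurable_sqr (mh n))).
have f0 n t : `[0%R, 1%R]%classic t -> (0 <= ((\1_A (g, t) * f n (g, t)) ^+ 2)%:E)%E.
  by move=> _; rewrite lee_fin sqr_ge0.
have := @fatou _ _ R (@lebesgue_measure R) _ (measurable_itv `[0%R, 1%R]) _ m2 f0.
move=> /le_trans; apply.
rewrite limn_einf_lim; apply: lime_le.
  exact: is_cvg_einfs.
near=> n; apply: ereal_inf_le; exists (\int[@lebesgue_measure R]_(t in `[0%R, 1%R])
    ((\1_A (g, t) * f n (g, t)) ^+ 2)%:E)%E; first by exists n => /=.
apply: le_trans (fg n); apply: ge0_le_integral.
- exact: measurable_itv.
- exact: f0.
- exact: m2.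
- exact: (slice g (measurable_sqr (mf n))).
move=> t _; rewrite lee_fin exprMn ler_piMl ?sqr_ge0 // indA.
Unshelve. all: by end_near.
Qed.

End Complete.
End L2.

(** * Near-minimisers of the energy and the closed gradient *)

Section MinimizingSequence.
Variables (R : realType) (Q : probability (G0m R) R) (u : G0m R -> R).
Hypothesis u_lip : forall g h : G0m R, `|u g - u h| <= L2dist (G0fun g) (G0fun h).

Let eps (n : nat) : R := n.+1%:R^-1.

Let eps_gt0 n : 0 < eps n. Proof. by rewrite invr_gt0. Qed.

Let eps_le n m : (n <= m)%N -> eps m <= eps n.
Proof. by move=> nm; rewrite lef_pV2 ?posrE // ler_nat. Qed.

Let eps_near (e : R) : 0 < e -> \forall n \near \oo, eps n <= e.
Proof.
move=> e0; have := near_infty_natSinv_lt (PosNum e0).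
by apply: filterS => n /= /ltW.
Qed.

Let integral_const (c : R) : (\int[Q]_g c%:E = c%:E)%E.
Proof.
transitivity (c%:E * Q setT)%E; first exact: integral_cst.
by rewrite (probability_setT Q) mule1.
Qed.

Let energy (z : Z1data R) : \bar R := iint01 Q (fun x => (z_grad z x.1 x.2 ^+ 2)%:E).

Let energy_itv e z : good u e z -> exists2 a : R, 0 <= a <= 1 & energy z = a%:E.
Proof.
move=> [_ z1 _ mz].
have e0 : (0 <= energy z)%E by apply: iint01_ge0 => x; rewrite lee_fin sqr_ge0.
have e1 : (energy z <= 1)%E.
  apply: (@le_trans _ _ (\int[Q]_g 1)%E).
    apply: ge0_le_integral => //.
    - by move=> g _; apply: integral_ge0 => t _; rewrite lee_fin sqr_ge0.
    - apply: (@measurable_integral01 R (fun x => (z_grad z x.1 x.2 ^+ 2)%:E)).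
        exact: measurable_sqr.
      by move=> x; rewrite lee_fin sqr_ge0.
    - by move=> g _; exact: z1.
  by rewrite integral_const.
have ef : energy z \is a fin_num by rewrite ge0_fin_numE // (le_lt_trans e1) // ltry.
by exists (fine (energy z)); rewrite ?fineK // -!lee_fin fineK // e0 e1.
Qed.

Let A n : set R := [set fine (energy z) | z in [set z | good u (eps n) z]].

Let A0 n : A n !=set0.
Proof. by have [z gz] := good_exists u_lip (eps_gt0 n); exists (fine (energy z)), z. Qed.

Let A_inf n : has_inf (A n).
Proof.
split=> //; exists 0 => _ [z gz <-].
by have [a /andP[a0 _] ->] := energy_itv gz.
Qed.

Let r n : R := inf (A n).

Let good_le n m z : (n <= m)%N -> good u (eps m) z -> good u (eps n) z.
Proof.
by move=> nm [h1 h2 h3 h4]; split => // g; apply: le_trans (h1 g) (eps_le nm).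
Qed.

Let r_le n z : good u (eps n) z -> r n <= fine (energy z).
Proof. by move=> gz; apply: ge_inf; [case: (A_inf n)|exists z]. Qed.

(** A smaller tolerance leaves fewer competitors. Being bounded by 1 as well, r converges, which
    makes the gaps between near-minimisers small. *)
Let r_homo : {homo r : n m / (n <= m)%N >-> n <= m}.
Proof.
move=> n m nm; apply: lb_le_inf => // _ [z gz <-].
by apply: r_le; exact: good_le gz.
Qed.

Let r_le1 n : r n <= 1.
Proof.
have [z gz] := good_exists u_lip (eps_gt0 n).
apply: le_trans (r_le gz) _.
by have [a /andP[_ a1] ->] := energy_itv gz.
Qed.

Let minimizer n : exists z, good u (eps n) z /\ fine (energy z) < r n + eps n.
Proof.
have [_ [z gz <-] h] := inf_adherent (eps_gt0 n) (A_inf n).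
by exists z.
Qed.

Let gap z1 z2 : \bar R := iint01 Q (fun x => ((z_grad z1 x.1 x.2 - z_grad z2 x.1 x.2) ^+ 2)%:E).

(* Parallelogram identity: near-minimisers of the energy over the nested convex
   sets [good u (eps n)] form a Cauchy sequence, because midpoints stay in the set. *)
Let gap_le n m z1 z2 : (n <= m)%N -> good u (eps n) z1 -> good u (eps m) z2 ->
  fine (energy z1) < r n + eps n -> fine (energy z2) < r m + eps m ->
  (gap z2 z1 <= (2 * (r m - r n) + 4 * eps n)%:E)%E.
Proof.
move=> nm g1 g2 e1 e2.
have [z gz zE] := good_midpoint (lexx (eps n)) (eps_le nm) g1 g2.
have rz := r_le gz.
have [a1 _ E1] := energy_itv g1; have [a2 _ E2] := energy_itv g2.
have [a _ E] := energy_itv gz.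
have [_ _ _ m1] := g1; have [_ _ _ m2] := g2.
have := parallelogram Q m2 m1.
rewrite -/(gap z2 z1) -/(energy z1) -/(energy z2) E1 E2.
rewrite (_ : iint01 Q _ = energy z); last first.
  by congr iint01; apply/funext => x; rewrite zE (addrC (z_grad z1 _ _)).
rewrite E -!EFinM -EFinD => H.
have gap0 : (0 <= gap z2 z1)%E by apply: iint01_ge0 => x; rewrite lee_fin sqr_ge0.
have : gap z2 z1 \is a fin_num.
  rewrite ge0_fin_numE // -(@lteD2rE _ (4 * a)%:E) // H.
  by rewrite addye // ltry.
move: H => /[swap] gf; rewrite -(fineK gf) -EFinD => -[H].
rewrite lee_fin; move: e1 e2 rz; rewrite E1 E2 E /= => e1 e2 rz.
have := eps_le nm; lra.
Qed.

Lemma gradient_exists : exists F : G0m R -> R -> R,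
  closed_gradient Q u F /\ forall g, (carre_du_champ F g <= 1)%E.
Proof.
have [z zP] := choice minimizer.
have zg n : good u (eps n) (z n) by have [] := zP n.
have ze n : fine (energy (z n)) < r n + eps n by have [] := zP n.
have r_cvg : cvgn r.
  apply: nondecreasing_is_cvgn; first exact: r_homo.
  by exists 1 => _ [n _ <-]; exact: r_le1.
have r_lim n : r n <= limn r by apply: nondecreasing_cvgn_le => //; exact: r_homo.
have exK (k : nat) : exists K : nat, forall n m, (K <= n)%N -> (n <= m)%N ->
    (gap (z m) (z n) <= ((4^-1) ^+ k)%:E)%E.
  (* The gap is at most 2 (r m - r n) + 4 eps n, hence at most 6/8 of 4^-k. *)
  have d0 : 0 < (4^-1) ^+ k / 8 :> R by rewrite divr_gt0 // exprn_gt0.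
  have [K _ KP] : \forall n \near \oo, limn r - r n <= (4^-1) ^+ k / 8 /\ eps n <= (4^-1) ^+ k / 8.
    near=> n; split; last by near: n; exact: eps_near.
    have : `|limn r - r n| <= (4^-1) ^+ k / 8.
      by near: n; move/cvgrPdist_le : r_cvg; apply.
    by apply: le_trans; exact: ler_norm.
  exists K => n m Kn nm; have [h1 h2] := KP n Kn.
  apply: le_trans (gap_le nm (zg n) (zg m) (ze n) (ze m)) _.
  by rewrite lee_fin; have := r_lim m; lra.
have [K KP] := choice exK.
(* Partial sums make the extraction increasing and at least both K k and k. *)
pose phi k := (\sum_(i < k.+1) (K i).+1)%N.
have phiS k : phi k.+1 = (phi k + (K k.+1).+1)%N by rewrite /phi big_ord_recr.
have phiK k : (K k <= phi k)%N.
  by rewrite /phi big_ord_recr /=; apply: leq_trans (leqnSn _) (leq_addl _ _).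
have phi_ge k : (k <= phi k)%N.
  elim: k => // k IH; rewrite phiS addnS ltnS.
  exact: leq_trans IH (leq_addr _ _).
pose f k (x : G0m R * R) := z_grad (z (phi k)) x.1 x.2.
have mf k : measurable_fun setT (f k) by have [] := zg (phi k).
have fC k : (iint01 Q (fun x => ((f k.+1 x - f k x) ^+ 2)%:E) <= ((4^-1) ^+ k)%:E)%E.
  by apply: (KP k (phi k) (phi k.+1)) => //; rewrite phiS leq_addr.
have [F [mF cF F1]] := L2_complete mf fC.
exists (fun g t => F (g, t)); split; last first.
  by move=> g; apply: F1 => k; have [_ h _ _] := zg (phi k); exact: h.
have uE k g : `|z_fun (z (phi k)) g - u g| <= eps k.
  by have [h _ _ _] := zg (phi k); apply: le_trans (h g) (eps_le (phi_ge k)).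
have mzf k : measurable_fun setT (fun g : G0m R => z_fun (z (phi k)) g).
  by have [] := zg (phi k).
have eps0 : eps n @[n --> \oo] --> (0 : R).
  by apply/cvgrPdist_le => e e0; near=> n; rewrite sub0r normrN gtr0_norm //;
    near: n; exact: eps_near.
(* Measurability of u is derived: u is a pointwise limit of measurable cylinder functions. *)
have mu : measurable_fun setT u.
  apply: (@measurable_fun_cvg _ _ _ _ (fun k (g : G0m R) => z_fun (z (phi k)) g)) => // g _.
  apply/cvgrPdist_le => e e0; near=> k; rewrite distrC; apply: le_trans (uE k g) _.
  by near: k; exact: eps_near.
split => //.
  by rewrite (_ : (fun p : G0m R * R => _) = F) //; apply/funext => -[].
exists (fun k => z (phi k)); split; last exact: cF.
have : (eps n ^+ 2)%:E @[n --> \oo] --> (0 : R)%:E.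
  apply: cvg_EFin; first by near=> n.
  rewrite -(mul0r 0); under eq_fun do rewrite expr2; exact: cvgM.
apply: squeeze_cvge; last exact: cvg_cst.
near=> n; apply/andP; split; first by apply: integral_ge0 => g _; rewrite lee_fin sqr_ge0.
apply: (@le_trans _ _ (\int[Q]_g (eps n ^+ 2)%:E)%E); last first.
  by rewrite integral_const.
apply: ge0_le_integral => //.
- by move=> g _; rewrite lee_fin sqr_ge0.
- by apply/measurable_EFinP; apply: measurable_funX; exact: measurable_funB.
- move=> g _; rewrite lee_fin -[leLHS]real_normK ?num_real //.
  by rewrite ler_pXn2r ?nnegrE // ltW.
Unshelve. all: by end_near.
Qed.

End MinimizingSequence.

Unset Implicit Arguments.

Theorem theorem7p9 (R : realType) (beta : R) (beta_gt0 : 0 < beta)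
    (Q : probability (G0m R) R) (HQ : entropic_measure beta Q)
    (u : G0m R -> R)
    (u_lip : forall g h : G0m R, `|u g - u h| <= L2dist (G0fun g) (G0fun h)) :
  exists F : G0m R -> R -> R,
    closed_gradient Q u F /\
    {ae Q, forall g : G0m R, (carre_du_champ F g <= 1)%E}.
Proof.
have [F [cF F1]] := gradient_exists Q u_lip.
by exists F; split => //; exact: aeW.
Qed.
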